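(* Let $(M,g_{ij})$ be an $n$-dimensional Riemannian manifold, let $\tau\in\mathbb{R}^m_+$, let $\Omega_{0\tau}=\{t\in\mathbb{R}^m: 0\le t^\alpha\le \tau^\alpha,\ \alpha=1,\dots,m\}$, and consider the multitime optimal control problem $$\max_{u(\cdot)} V(u(\cdot)),\qquad V(u(\cdot))=-\int_{\Omega_{0\tau}}\sqrt{\det(g_{\alpha\beta})}\,dt,\qquad g_{\alpha\beta}(t)=g_{ij}(x(t))\,u^i_\alpha(t)\,u^j_\beta(t),$$ subject to $$\frac{\partial x^i}{\partial t^\alpha}(t)=u^i_\alpha(t),\quad i=1,\dots,n,\ \alpha=1,\dots,m,\qquad u\in\mathcal{U},\ t\in\Omega_{0\tau},\qquad x(0)=x_0,\ x(\tau)=x_1,$$ where $\mathcal{U}$ is the set of controls $u=(u_\alpha)=(u^i_\alpha):\Omega_{0\tau}\to\mathbb{R}^{mn}$, consisting of $C^1$ linearly independent control vectors $u_1,\dots,u_m$, that satisfy the complete integrability conditions $\frac{\partial u^i_\alpha}{\partial t^\beta}=\frac{\partial u^i_\beta}{\partial t^\alpha}$ for all $i,\alpha,\beta$. Then a $C^2$ solution $x(\cdot)$ of this optimal control problem is a solution of the boundary problem $$\frac{\partial L}{\partial x^i}-D_\alpha\left(g\,g^{\beta\gamma}\,\frac{\partial g_{\beta\gamma}}{\partial x^i_\alpha}\right)=0,\qquad x(0)=x_0,\quad x(\tau)=x_1,$$ i.e., it is a minimal submanifold.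
   Context: Summation over repeated indices is used: Latin indices run from $1$ to $n$, Greek indices from $1$ to $m$; $dt=dt^1\wedge\dots\wedge dt^m$. Everything is written in local coordinates $(x^1,\dots,x^n)$ on $M$. A $C^2$ solution of the system $\partial x^i/\partial t^\alpha=u^i_\alpha$ is a submanifold ($m$-sheet) $x^i=x^i(t^1,\dots,t^m)$; the controls may possibly also be fixed on the boundary $\partial\Omega_{0\tau}$. The Lagrangian is $L(x,u)=-\sqrt{\det(g_{\alpha\beta})}$ with $g_{\alpha\beta}=g_{ij}(x)u^i_\alpha u^j_\beta$, and $x^i_\alpha=\partial x^i/\partial t^\alpha=u^i_\alpha$. The partial derivatives $\partial/\partial x^i$ and $\partial/\partial x^i_\alpha$ treat $x^i$ and $x^i_\alpha$ as independent variables. In the boundary problem, $g=\det(g_{\alpha\beta})$, $(g^{\beta\gamma})$ is the inverse matrix of $(g_{\beta\gamma})$, and $D_\alpha$ is the total derivative operator with respect to $t^\alpha$. Minimal submanifolds are those with zero mean curvature.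
   Formalization: The printed coefficient g in the boundary problem is replaced by -(1/2)√g, so the term is ∂L/∂x^i_α; as printed it fails for m=n=1, x=t+t² on [0,1]. M is taken as one coordinate domain, and all τ^α are positive. *)

(* Defs.v *)
From HB Require Import structures.
From mathcomp Require Export all_boot all_order all_algebra.
From mathcomp Require Export all_classical all_reals all_analysis.

Set Implicit Arguments.
Unset Strict Implicit.
Unset Printing Implicit Defensive.

Import Order.TTheory GRing.Theory Num.Theory.
Import numFieldNormedType.Exports.

Local Open Scope classical_set_scope.
Local Open Scope ring_scope.

(* Points of R^p are row vectors; a family (v_a^i) with a = 1..m, i = 1..n is
   an m x n matrix whose a-th row is the vector v_a. *)

Section Calculus.
Variables (R : realType) (p : nat).
Implicit Types (f : 'rV[R]_p -> R) (t : 'rV[R]_p) (W K : set 'rV[R]_p).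

Definition pd (i : 'I_p) f t : R := 'D_(delta_mx 0 i) f t.

(* Meant for W open. *)
Fixpoint Ck (k : nat) W f : Prop :=
  if k is k'.+1 then
    (forall t, W t -> differentiable f t) /\
    (forall i, Ck k' W (pd i f))
  else forall t, W t -> {for t, continuous f}.

Definition smooth W f : Prop := forall k, Ck k W f.

(* C^k on a closed set: C^k on some open neighbourhood of it.  On a box the
   derivatives at boundary points are determined by the values on the box. *)
Definition Ck_on (k : nat) K f : Prop :=
  exists W, [/\ open W, K `<=` W & Ck k W f].

Definition box (tau : 'rV[R]_p) : set 'rV[R]_p :=
  [set t | forall a, 0 <= t 0 a <= tau 0 a].

Definition box_boundary (tau : 'rV[R]_p) : set 'rV[R]_p :=
  box tau `\` (box tau)°.

End Calculus.

(* Iterated Lebesgue integral over [0, tau^1] x ... x [0, tau^p]; by Fubini it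
   is the integral with respect to dt^1 ... dt^p, since it is only applied to
   integrands that are continuous on the box. *)
Fixpoint box_integral (R : realType) (p : nat) :
    'rV[R]_p -> ('rV[R]_p -> R) -> R :=
  if p is q.+1 then fun tau f =>
    \int[@lebesgue_measure R]_(s in `[0, tau 0 ord0])
      box_integral (rsubmx (tau : 'rV[R]_(1 + q)))
        (fun t => f (row_mx s%:M t : 'rV[R]_(1 + q)))
  else fun _ f => f 0.

(* A Riemannian manifold in local coordinates x^1, ..., x^n. *)
Record riemannian_chart (R : realType) (n : nat) := RiemannianChart {
  chart_dom : set 'rV[R]_n;
  metric : 'rV[R]_n -> 'M[R]_n;
  chart_dom_open : open chart_dom;
  metric_sym : forall x, chart_dom x -> (metric x)^T = metric x;
  metric_pos : forall x, chart_dom x ->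
    forall v : 'rV[R]_n, v != 0 -> 0 < (v *m metric x *m v^T) 0 0;
  metric_smooth : forall i j, smooth chart_dom (fun x => metric x i j)
}.

Section OptimalControl.
Variables (R : realType) (m n : nat) (M : riemannian_chart R n).
Implicit Types (x : 'rV[R]_m -> 'rV[R]_n) (u : 'rV[R]_m -> 'M[R]_(m, n)).
Implicit Types (y : 'rV[R]_n) (v : 'M[R]_(m, n)) (t tau : 'rV[R]_m).

(* g_{ab} = g_{ij}(y) v^i_a v^j_b *)
Definition induced_metric y v : 'M[R]_m := v *m metric M y *m v^T.

Definition lagrangian y v : R := - Num.sqrt (\det (induced_metric y v)).

Definition cost tau x u : R :=
  - box_integral tau (fun t => Num.sqrt (\det (induced_metric (x t) (u t)))).

Record control tau u : Prop := Control {
  control_C1 : forall a i, Ck_on 1 (box tau) (fun t => u t a i);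
  control_free : forall t, box tau t -> row_free (u t);
  control_integrable : forall t, box tau t -> forall (a b : 'I_m) (i : 'I_n),
    pd b (fun s => u s a i) t = pd a (fun s => u s b i) t
}.

(* [ub] selects between the problem in which the controls are free on the
   boundary of the box ([None]) and the one in which they are prescribed there
   ([Some w]). *)
Record feasible tau (x0 x1 : 'rV[R]_n)
    (ub : option ('rV[R]_m -> 'M[R]_(m, n))) x u : Prop := Feasible {
  feasible_control : control tau u;
  feasible_boundary :
    if ub is Some w then forall t, box_boundary tau t -> u t = w t else True;
  feasible_dom : forall t, box tau t -> chart_dom M (x t);
  feasible_state : forall t, box tau t -> forall (a : 'I_m) (i : 'I_n),
    is_derive t (delta_mx 0 a) (fun s => x s 0 i) (u t a i);
  feasible_start : x 0 = x0;
  feasible_end : x tau = x1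
}.

Definition optimal tau (x0 x1 : 'rV[R]_n)
    (ub : option ('rV[R]_m -> 'M[R]_(m, n))) x u : Prop :=
  feasible tau x0 x1 ub x u /\
  forall x' u', feasible tau x0 x1 ub x' u' -> cost tau x' u' <= cost tau x u.

(* x^i_a = dx^i / dt^a *)
Definition velocity x t : 'M[R]_(m, n) :=
  \matrix_(a < m, i < n) pd a (fun s => x s 0 i) t.

Definition dL_dx (i : 'I_n) y v : R := pd i (fun z => lagrangian z v) y.

(* - (1/2) sqrt(g) g^{bc} dg_{bc}/dx^i_a, which is dL/dx^i_a by Jacobi's formula
   for the derivative of a determinant.  The source prints the coefficient as
   g instead of - (1/2) sqrt(g); with that coefficient, optimal sheets need not
   satisfy the equation: for m = 1 in Euclidean space it reads x'' = 0, but
   straight segments of nonconstant speed are optimal too. *)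
Definition momentum (i : 'I_n) (a : 'I_m) y v : R :=
  - 2^-1 * Num.sqrt (\det (induced_metric y v)) *
  \sum_(b < m) \sum_(c < m)
    invmx (induced_metric y v) b c *
    'D_(delta_mx a i) (fun w : 'M[R]_(m, n) => induced_metric y w b c) v.

Definition euler_lagrange tau x : Prop :=
  forall t, box tau t -> forall i,
    dL_dx i (x t) (velocity x t)
    - \sum_(a < m) pd a (fun s => momentum i a (x s) (velocity x s)) t = 0.

Definition boundary_problem tau (x0 x1 : 'rV[R]_n) x : Prop :=
  [/\ euler_lagrange tau x, x 0 = x0 & x tau = x1].

(* Gamma^k_{ij} = (1/2) g^{kl} (d_i g_{jl} + d_j g_{il} - d_l g_{ij}) *)
Definition christoffel (k i j : 'I_n) y : R :=
  2^-1 * \sum_(l < n) invmx (metric M y) k l *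
    (pd i (fun z => metric M z j l) y + pd j (fun z => metric M z i l) y
     - pd l (fun z => metric M z i j) y).

(* Covariant derivative of x_b in the direction t^a. *)
Definition cov_velocity x t (a b : 'I_m) : 'rV[R]_n :=
  \row_(k < n)
    (pd a (fun s => pd b (fun r => x r 0 k) s) t
     + \sum_(i < n) \sum_(j < n)
         christoffel k i j (x t) * velocity x t a i * velocity x t b j).

(* Y - g^{cd} <Y, v_c> v_d: the component of Y orthogonal to the rows of v. *)
Definition normal_part y v (Y : 'rV[R]_n) : 'rV[R]_n :=
  Y - Y *m metric M y *m v^T *m invmx (induced_metric y v) *m v.

Definition second_fundamental_form x t (a b : 'I_m) : 'rV[R]_n :=
  normal_part (x t) (velocity x t) (cov_velocity x t a b).

(* Trace of the second fundamental form, not divided by m. *)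
Definition mean_curvature x t : 'rV[R]_n :=
  \sum_(a < m) \sum_(b < m)
    invmx (induced_metric (x t) (velocity x t)) a b
      *: second_fundamental_form x t a b.

Definition minimal tau x : Prop :=
  forall t, box tau t -> mean_curvature x t = 0.

End OptimalControl.

(* Main.v *)
(* Vary an optimal sheet x in one coordinate, x + e eta e_k, with eta a C^2 bump
   function supported in the open box: for small e the varied sheet is feasible,
   so the derivative of the area at e = 0 vanishes.  That derivative is taken
   under the integral and integrated by parts, so that the k-th Euler-Lagrange
   expression integrates to 0 against every bump; being continuous, it vanishes
   in the open box and, by density, on the closed one.  Rewritten with the
   Christoffel symbols, the Euler-Lagrange equation says that g^{ab} nabla_a x_b
   is tangent to the sheet; its normal part is the mean curvature vector. *)

(* Sheet and control have to be varied together: adding e eta e_k to x forces adding e (d_a eta) e_k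
   to u_a. The new control is integrable because the second derivatives of eta commute, which is
   checked on the explicit bump. Endpoints, and boundary controls when they are prescribed, do not
   move because eta and its gradient vanish off the open box; one argument thus serves both versions
   of the problem. The other constraints, chart membership and linear independence, are open
   conditions, and compactness of the box gives a range of e valid at all t simultaneously.

   The analysis is shaped by the integral being iterated: linearity, monotonicity, vanishing and
   integration by parts are proved by induction on the dimension for continuous integrands, and
   differentiation under the integral rests on estimates uniform over the compact box.

   Since x is C^2 on a neighbourhood of the box, the velocity derivative of the area density is C^1
   along the sheet, so the integration by parts is legitimate as it stands. *)
Require Import Defs.
From mathcomp Require Import perm ring lra.

Set Implicit Arguments.
Unset Strict Implicit.
Unset Printing Implicit Defensive.

Import Order.TTheory GRing.Theory Num.Theory.
Import numFieldNormedType.Exports.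
Local Open Scope classical_set_scope.
Local Open Scope ring_scope.

(** * Derivatives and limits of matrix expressions *)

Section PointwiseDerivative.
Context {R : realType} {V : normedModType R}.
Implicit Types (f g : V -> R) (t d : V).

Lemma is_derive_add f g t d df dg :
  is_derive t d f df -> is_derive t d g dg ->
  is_derive t d (fun s => f s + g s) (df + dg).
Proof. exact: is_deriveD. Qed.

Lemma is_derive_mul f g t d df dg :
  is_derive t d f df -> is_derive t d g dg ->
  is_derive t d (fun s => f s * g s) (df * g t + f t * dg).
Proof.
by move=> hf hg; rewrite addrC [df * _]mulrC; exact: is_deriveM.
Qed.

Lemma is_derive_bigsum (I : Type) (r : seq I) (P : pred I) (F : I -> V -> R)
    (dF : I -> R) t d :
  (forall i, P i -> is_derive t d (F i) (dF i)) ->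
  is_derive t d (fun s => \sum_(i <- r | P i) F i s) (\sum_(i <- r | P i) dF i).
Proof.
move=> hF; elim: r => [|i r IH].
  under eq_fun do rewrite big_nil.
  by rewrite big_nil; exact: is_derive_cst.
under eq_fun do rewrite big_cons.
rewrite big_cons; case: ifPn => // Pi.
exact: is_derive_add (hF _ Pi) IH.
Qed.

Lemma is_derive_bigprod n (F : 'I_n -> V -> R) (dF : 'I_n -> R) t d :
  (forall i, is_derive t d (F i) (dF i)) ->
  is_derive t d (fun s => \prod_i F i s)
    (\sum_i \prod_k (if k == i then dF k else F k t)).
Proof.
elim: n F dF => [|n IH] F dF hF.
  under eq_fun do rewrite big_ord0.
  by rewrite big_ord0; exact: is_derive_cst.
under eq_fun do rewrite big_ord_recl.
rewrite big_ord_recl big_ord_recl eqxx.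
have -> : \prod_(i < n) (if lift ord0 i == ord0 then dF (lift ord0 i)
   else F (lift ord0 i) t) = \prod_(i < n) F (lift ord0 i) t.
  by apply: eq_bigr.
have -> : \sum_(i < n) \prod_k (if k == lift ord0 i then dF k else F k t) =
   F ord0 t * \sum_(i < n) \prod_k
     (if k == i then dF (lift ord0 k) else F (lift ord0 k) t).
  rewrite big_distrr /=; apply: eq_bigr => i _; rewrite big_ord_recl /=.
  by congr (_ * _); apply: eq_bigr => k _; rewrite (inj_eq lift_inj).
exact: is_derive_mul (hF _)
  (IH (fun i => F (lift ord0 i)) (fun i => dF (lift ord0 i)) (fun i => hF _)).
Qed.

Lemma is_derive_mulmx_entry p q r (A : V -> 'M[R]_(p, q)) (B : V -> 'M[R]_(q, r))
    (dA : 'M[R]_(p, q)) (dB : 'M[R]_(q, r)) t d :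
  (forall i j, is_derive t d (fun s => A s i j) (dA i j)) ->
  (forall i j, is_derive t d (fun s => B s i j) (dB i j)) ->
  forall i j, is_derive t d (fun s => (A s *m B s) i j)
    ((dA *m B t + A t *m dB) i j).
Proof.
move=> hA hB i j; under eq_fun do rewrite mxE.
rewrite !mxE -big_split /=.
by apply: is_derive_bigsum => k _; exact: is_derive_mul.
Qed.

(* Jacobi's formula: the terms with the i-th factor differentiated add up to
   the determinant of A with its i-th row replaced by that of dA. *)
Lemma is_derive_det p (A : V -> 'M[R]_p) (dA : 'M[R]_p) t d :
  (forall i j, is_derive t d (fun s => A s i j) (dA i j)) ->
  is_derive t d (fun s => \det (A s)) (\tr (\adj (A t) *m dA)).
Proof.
move=> hA.
pose B i := \matrix_(k, j) (if k == i then dA k j else A t k j).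
have -> : \tr (\adj (A t) *m dA) = \sum_i \det (B i).
  rewrite mxtrace_mulC; apply: eq_bigr => i _.
  (* Cofactors along row i do not see that row, so those of [B i] are those of [A t]. *)
  rewrite (expand_det_row _ i) mxE; apply: eq_bigr => j _.
  rewrite !mxE eqxx /cofactor; congr (_ * (_ * \det _)).
  apply/matrixP => k l; rewrite !mxE.
  by rewrite eq_sym (negbTE (neq_lift _ _)).
rewrite /determinant exchange_big /=.
apply: is_derive_bigsum => s _; rewrite -big_distrr /=.
have -> : \sum_(i < p) \prod_k B i k (s k) =
  \sum_i \prod_k (if k == i then dA k (s k) else A t k (s k)).
  by apply: eq_bigr => i _; apply: eq_bigr => k _; rewrite mxE.
have := is_derive_mul (is_derive_cst ((-1) ^+ s : R) t d)
  (is_derive_bigprod (fun i => hA i (s i))).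
by rewrite mul0r add0r.
Qed.

(** Restriction to the line through [t] in direction [d] makes the chain rules for functions of one
    real variable available to directional derivatives. *)
Lemma derive_line (W : normedModType R) (f : V -> W) t d :
  'D_d f t = 'D_1 (fun h : R => f (h *: d + t)) 0.
Proof.
rewrite /derive; set a := (X in lim (X @ _)); set b := (X in _ = lim (X @ _)).
suff -> : a = b by [].
by apply/funext => h; rewrite /a /b /= addr0 scale0r add0r [h%:A]mulr1.
Qed.

Lemma is_derive_comp1 f (psi : R -> R) t d df dpsi :
  is_derive t d f df -> is_derive (f t) 1 psi dpsi ->
  is_derive t d (psi \o f) (dpsi * df).
Proof.
move=> [hf <-] hpsi.
have hF := (derivable1P f t d).1 hf.
have f0 : (fun h : R => f (h *: d + t)) 0 = f t by rewrite scale0r add0r.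
have hpsi' : derivable psi (f (0 *: d + t)) 1.
  by rewrite scale0r add0r; exact: ex_derive.
have key := derive1_comp hF hpsi'.
apply: DeriveDef.
  apply: (derivable1P (psi \o f) t d).2; apply: (derivable1_diffP _ _).2.
  apply: (@differentiable_comp _ _ _ _ (fun h : R => f (h *: d + t)) psi).
    exact: (derivable1_diffP (fun h : R => f (h *: d + t)) 0).1 hF.
  exact: (derivable1_diffP psi _).1 hpsi'.
rewrite derive_line -derive1E key.
by rewrite !derive1E -derive_line /= scale0r add0r derive_val.
Qed.

(** The inner map is only known to be derivable along [d]. On that line it is a function of one real
    variable, for which derivable means differentiable, and the chain rule for differentials
    applies. *)
Lemma is_derive_comp p (y : V -> 'rV[R]_p) (dy : 'rV[R]_p)
    (g : 'rV[R]_p -> R) t d :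
  (forall i, is_derive t d (fun s => y s 0 i) (dy 0 i)) ->
  differentiable g (y t) ->
  is_derive t d (g \o y) (\sum_i dy 0 i * pd i g (y t)).
Proof.
move=> hy hg.
have hy' : derivable y t d.
  by apply/derivable_mxP => i j; rewrite ord1; exact: ex_derive.
have yE : 'D_d y t = dy.
  rewrite derive_mx//; apply/rowP => j.
  by rewrite mxE [LHS]derive_val.
pose Y := fun h : R => y (h *: d + t).
have hY : differentiable Y 0.
  exact: (derivable1_diffP Y 0).1 ((derivable1P y t d).1 hy').
have Y0 : Y 0 = y t by rewrite /Y scale0r add0r.
have dY : 'd Y 0 1 = dy.
  by rewrite -deriveE// -yE derive_line.
have hgY : differentiable g (Y 0) by rewrite Y0.
have hgY' := differentiable_comp hY hgY.
apply: DeriveDef.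
  exact: (derivable1P (g \o y) t d).2 ((derivable1_diffP _ _).2 hgY').
rewrite derive_line; transitivity ('D_1 (g \o Y) 0); first by [].
rewrite deriveE// diff_comp//= dY Y0 {1}(row_sum_delta dy) linear_sum /=.
by apply: eq_bigr => i _; rewrite linearZ /= /pd deriveE.
Qed.

End PointwiseDerivative.

(** * Limits of sums, products, determinants and matrices along a filter *)

Section Limits.
Context {R : realType} {T : Type} {F : set_system T} {FF : Filter F}.

Lemma cvg_bigsum (I : Type) (r : seq I) (P : pred I) (f : I -> T -> R) (l : I -> R) :
  (forall i, P i -> f i x @[x --> F] --> l i) ->
  \sum_(i <- r | P i) f i x @[x --> F] --> \sum_(i <- r | P i) l i.
Proof. by apply: cvg_big; exact: add_continuous. Qed.

Lemma cvg_bigprod (I : Type) (r : seq I) (P : pred I) (f : I -> T -> R) (l : I -> R) :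
  (forall i, P i -> f i x @[x --> F] --> l i) ->
  \prod_(i <- r | P i) f i x @[x --> F] --> \prod_(i <- r | P i) l i.
Proof. by apply: cvg_big; exact: mul_continuous. Qed.

Lemma cvg_det p (A : T -> 'M[R]_p) (B : 'M[R]_p) :
  (forall i j, A x i j @[x --> F] --> B i j) ->
  \det (A x) @[x --> F] --> \det B.
Proof.
move=> h; apply: cvg_bigsum => s _; apply: cvgM; first exact: cvg_cst.
exact: cvg_bigprod.
Qed.

Lemma cvg_mulmx_entry p q r (A : T -> 'M[R]_(p, q)) (B : T -> 'M[R]_(q, r))
    (A0 : 'M[R]_(p, q)) (B0 : 'M[R]_(q, r)) :
  (forall i j, A x i j @[x --> F] --> A0 i j) ->
  (forall i j, B x i j @[x --> F] --> B0 i j) ->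
  forall i j, (A x *m B x) i j @[x --> F] --> (A0 *m B0) i j.
Proof.
move=> hA hB i j; under eq_cvg do rewrite mxE.
by rewrite mxE; apply: cvg_bigsum => k _; exact: cvgM.
Qed.

Lemma cvg_adj_entry p (A : T -> 'M[R]_p) (B : 'M[R]_p) :
  (forall i j, A x i j @[x --> F] --> B i j) ->
  forall i j, (\adj (A x)) i j @[x --> F] --> (\adj B) i j.
Proof.
move=> h i j; under eq_cvg do rewrite mxE.
rewrite mxE; apply: cvgM; first exact: cvg_cst.
apply: cvg_det => k l; rewrite !mxE; have := h (lift j k) (lift i l).
by apply: cvg_trans; apply: near_eq_cvg; near=> x; rewrite !mxE.
Unshelve. all: by end_near.
Qed.

Lemma cvg_matrix p q (A : T -> 'M[R]_(p, q)) (B : 'M[R]_(p, q)) :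
  (forall i j, A x i j @[x --> F] --> B i j) -> A x @[x --> F] --> B.
Proof.
move=> h U [P BP PU]; rewrite /nbhs /=.
apply: (@filterS _ _ _ [set x | forall i j, P i j (A x i j)]).
  by move=> x; exact: PU.
by apply: filter_forall => i; apply: filter_forall => j; exact: (h i j _ (BP i j)).
Qed.

End Limits.

(** * Functions of class C^k *)

Lemma near_eq_differentiable (R : realType) (V W : normedModType R)
    (f g : V -> W) (t : V) :
  (\forall s \near t, f s = g s) -> differentiable f t -> differentiable g t.
Proof.
move=> fg df; have [dc fE] := (diff_locallyP t f).1 df.
have gE : g \o shift t = cst (g t) + 'd f t +o_ 0 id.
  apply/eqaddoP => e e0.
  have := (eqaddoP _ _ _ _).1 fE e e0; apply: filter_app.
  have nfg : \forall s \near 0, f (s + t) = g (s + t).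
    by move: fg; rewrite (near_shift 0); apply: filterS => s; rewrite /= subr0.
  near=> s; rewrite /= !fctE -(nbhs_singleton fg) (near nfg s)//.
have gd : 'd g t = 'd f t :> (V -> W) by exact: diff_unique.
by apply/diff_locallyP; rewrite gd.
Unshelve. all: by end_near. Qed.

Lemma is_derive_entry (R : realType) p q (A B : 'M[R]_(p, q)) i j :
  is_derive A B (fun M : 'M[R]_(p, q) => M i j) (B i j).
Proof.
apply: DeriveDef; first by apply: diff_derivable; exact: differentiable_coord.
have := @derive_mx _ _ _ _ id A B (@derivable_id _ _ _ _).
by rewrite derive_id => /matrixP /(_ i j); rewrite mxE => <-.
Qed.

Local Arguments Ck : simpl never.

Lemma CkS (R : realType) p k (W : set 'rV[R]_p) f :
  Ck k.+1 W f = ((forall t, W t -> differentiable f t) /\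
    (forall i, Ck k W (pd i f))).
Proof. by []. Qed.

Section Smoothness.
Context {R : realType} {p : nat}.
Implicit Types (f g : 'rV[R]_p -> R) (W : set 'rV[R]_p).

(** Openness turns agreement on [W] into agreement near each of its points, so derivatives agree as
    well. This lets a partial derivative be replaced by the sum, product or chain rule formula,
    which is only justified on [W]. *)
Lemma Ck_ext k W f g : open W -> (forall t, W t -> f t = g t) ->
  Ck k W f -> Ck k W g.
Proof.
move=> oW; elim: k f g => [|k IH] f g fg;
  have nfg0 t : W t -> \forall s \near t, f s = g s by
    move=> Wt; apply: filterS (open_nbhs_nbhs (conj oW Wt)) => s /fg.
  move=> hf t Wt; have nfg := nfg0 t Wt.
  have hft : f x @[x --> t] --> f t := hf t Wt.
  suff : g x @[x --> t] --> g t by [].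
  rewrite -(nbhs_singleton nfg); apply: cvg_trans hft.
  exact: near_eq_cvg nfg.
rewrite !CkS => -[df hf]; split=> [t Wt|i].
  exact: near_eq_differentiable (nfg0 t Wt) (df t Wt).
apply: IH (hf i) => t Wt.
exact: near_eq_derive (nfg0 t Wt).
Qed.

Lemma CkW k W f : Ck k.+1 W f -> Ck k W f.
Proof.
elim: k f => [|k IH] f; rewrite CkS => -[df hf].
  by move=> t Wt; apply/differentiable_continuous/df.
by split=> // i; exact: IH.
Qed.

Lemma Ck_sub k W W' f : W' `<=` W -> Ck k W f -> Ck k W' f.
Proof.
move=> WW'; elim: k f => [|k IH] f; first by move=> hf t /WW'; exact: hf.
rewrite !CkS => -[df hf]; split=> [t /WW'|i]; [exact: df | exact: IH].
Qed.

(** [Ck] is a pointwise condition on one global function, so nothing has to be matched on the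
    overlap. It serves to extend products with a bump by zero. *)
Lemma Ck_setU k W W' f : Ck k W f -> Ck k W' f -> Ck k (W `|` W') f.
Proof.
elim: k f => [|k IH] f; first by move=> h h' t [/h|/h'].
rewrite !CkS => -[df hf] [df' hf']; split=> [t [/df|/df']|i]//; exact: IH.
Qed.

Lemma pd_cst (c : R) i (t : 'rV[R]_p) : pd i (fun=> c) t = 0.
Proof. by rewrite /pd derive_val. Qed.

Lemma Ck_cst k W (c : R) : Ck k W (fun=> c).
Proof.
elim: k c => [|k IH] c; first by move=> t _; exact: cst_continuous.
rewrite CkS.
split=> [t _|i]; first exact: differentiable_cst.
by rewrite (_ : pd i _ = fun=> 0)//; apply/funext => t; exact: pd_cst.
Qed.

Lemma is_derive_pd f t i : differentiable f t ->
  is_derive t (delta_mx 0 i) f (pd i f t).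
Proof. by move=> df; apply: derivableP; exact: diff_derivable. Qed.

Lemma pdD f g i t : differentiable f t -> differentiable g t ->
  pd i (fun s => f s + g s) t = pd i f t + pd i g t.
Proof.
move=> /(@is_derive_pd _ _ i) hf /(@is_derive_pd _ _ i) hg.
by have h := is_derive_add hf hg; exact: derive_val.
Qed.

Lemma pdM f g i t : differentiable f t -> differentiable g t ->
  pd i (fun s => f s * g s) t = pd i f t * g t + f t * pd i g t.
Proof.
move=> /(@is_derive_pd _ _ i) hf /(@is_derive_pd _ _ i) hg.
by have h := is_derive_mul hf hg; exact: derive_val.
Qed.

Lemma CkD k W f g : open W -> Ck k W f -> Ck k W g ->
  Ck k W (fun t => f t + g t).
Proof.
move=> oW; elim: k f g => [|k IH] f g.
  by move=> hf hg t Wt; exact: cvgD (hf t Wt) (hg t Wt).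
rewrite !CkS => -[df hf] [dg hg]; split=> [t Wt|i].
  by apply: differentiableD; [exact: df | exact: dg].
apply: Ck_ext oW _ (IH _ _ (hf i) (hg i)) => t Wt.
by rewrite pdD//; [exact: df | exact: dg].
Qed.

Lemma CkM k W f g : open W -> Ck k W f -> Ck k W g ->
  Ck k W (fun t => f t * g t).
Proof.
move=> oW; elim: k f g => [|k IH] f g.
  by move=> hf hg t Wt; exact: cvgM (hf t Wt) (hg t Wt).
move=> Cf Cg; have [df hf] := Cf; have [dg hg] := Cg; rewrite CkS; split=> [t Wt|i].
  by apply: differentiableM; [exact: df | exact: dg].
apply: Ck_ext oW _ (CkD oW (IH _ _ (hf i) (CkW Cg)) (IH _ _ (CkW Cf) (hg i))).
by move=> t Wt; rewrite pdM//; [exact: df | exact: dg].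
Qed.

Lemma Ck_bigsum (I : Type) (r : seq I) (P : pred I) k W (f : I -> 'rV[R]_p -> R) :
  open W -> (forall i, P i -> Ck k W (f i)) ->
  Ck k W (fun t => \sum_(i <- r | P i) f i t).
Proof.
move=> oW hf; elim: r => [|i r IH].
  by under eq_fun do rewrite big_nil; exact: Ck_cst.
under eq_fun do rewrite big_cons.
by case Pi: (P i) => //; exact: CkD oW (hf i Pi) IH.
Qed.

Lemma Ck_bigprod (I : Type) (r : seq I) (P : pred I) k W (f : I -> 'rV[R]_p -> R) :
  open W -> (forall i, P i -> Ck k W (f i)) ->
  Ck k W (fun t => \prod_(i <- r | P i) f i t).
Proof.
move=> oW hf; elim: r => [|i r IH].
  by under eq_fun do rewrite big_nil; exact: Ck_cst.
under eq_fun do rewrite big_cons.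
by case Pi: (P i) => //; exact: CkM oW (hf i Pi) IH.
Qed.

Lemma Ck_det q k W (A : 'rV[R]_p -> 'M[R]_q) : open W ->
  (forall i j, Ck k W (fun t => A t i j)) -> Ck k W (fun t => \det (A t)).
Proof.
move=> oW hA; apply: Ck_bigsum => // s _; apply: CkM => //; first exact: Ck_cst.
exact: Ck_bigprod.
Qed.

Lemma Ck_adj q k W (A : 'rV[R]_p -> 'M[R]_q) : open W ->
  (forall i j, Ck k W (fun t => A t i j)) ->
  forall i j, Ck k W (fun t => (\adj (A t)) i j).
Proof.
move=> oW hA i j; under eq_fun do rewrite mxE.
apply: CkM => //; first exact: Ck_cst.
by apply: Ck_det => // a b; under eq_fun do rewrite !mxE.
Qed.

Lemma Ck_mulmx q r s k W (A : 'rV[R]_p -> 'M[R]_(q, r))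
    (B : 'rV[R]_p -> 'M[R]_(r, s)) : open W ->
  (forall i j, Ck k W (fun t => A t i j)) ->
  (forall i j, Ck k W (fun t => B t i j)) ->
  forall i j, Ck k W (fun t => (A t *m B t) i j).
Proof.
move=> oW hA hB i j; under eq_fun do rewrite mxE.
by apply: Ck_bigsum => // l _; exact: CkM.
Qed.

(** The outer derivative is asked for only at values taken by [f] on [W], which admits square root
    and inversion along functions that avoid 0. *)
Lemma Ck_comp1 k W f (psi dpsi : R -> R) : open W ->
  (forall t, W t -> is_derive (f t) 1 psi (dpsi (f t))) ->
  Ck k W (dpsi \o f) -> Ck k.+1 W f -> Ck k.+1 W (psi \o f).
Proof.
move=> oW hpsi Cpsi; rewrite !CkS => -[df hf]; split=> [t Wt|i].
  apply: differentiable_comp; first exact: df.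
  by apply/derivable1_diffP; have [] := hpsi t Wt.
apply: Ck_ext oW _ (CkM oW Cpsi (hf i)) => t Wt.
have := is_derive_comp1 (is_derive_pd i (df t Wt)) (hpsi t Wt).
by move=> h; rewrite [RHS]derive_val.
Qed.

Lemma Ck_coord k W (a : 'I_p) : Ck k W (fun t => t 0 a).
Proof.
case: k => [|k]; first by move=> t _; exact: coord_continuous.
rewrite CkS; split=> [t _|i]; first exact: differentiable_coord.
rewrite (_ : pd i _ = fun=> (delta_mx 0 i : 'rV[R]_p) 0 a); first exact: Ck_cst.
by apply/funext => t; have h := is_derive_entry t (delta_mx 0 i) 0 a; exact: derive_val.
Qed.

End Smoothness.

Lemma C1_comp (R : realType) p q (W : set 'rV[R]_p) (D : set 'rV[R]_q)
    (f : 'rV[R]_q -> R) (x : 'rV[R]_p -> 'rV[R]_q) :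
  open W -> (forall t, W t -> D (x t)) ->
  (forall i, Ck 1 W (fun t => x t 0 i)) -> Ck 1 D f -> Ck 1 W (f \o x).
Proof.
move=> oW WD hx; rewrite !CkS => -[df hf].
have dx t : W t -> differentiable x t.
  move=> Wt; rewrite (_ : x = fun s => \sum_i x s 0 i *: delta_mx 0 i); last first.
    by apply/funext => s; exact: row_sum_delta.
  rewrite -fct_sumE; apply: differentiable_sum => i.
  by apply: differentiableZl; exact: (hx i).1.
have cx t : W t -> {for t, continuous x} by move=> Wt; exact/differentiable_continuous/dx.
split=> [t Wt|i].
  by apply: differentiable_comp; [exact: dx | exact/df/WD].
apply: (@Ck_ext _ _ 0 _ (fun t => \sum_l pd i (fun s => x s 0 l) t * pd l f (x t))).
- exact: oW.
- move=> t Wt; have h : is_derive t (delta_mx 0 i) (f \o x)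
     (\sum_l (\row_l pd i (fun s => x s 0 l) t) 0 l * pd l f (x t)).
    apply: is_derive_comp; last exact/df/WD.
    by move=> l; rewrite mxE; apply: is_derive_pd; exact: (hx l).1.
  by rewrite [RHS]derive_val; apply: eq_bigr => l _; rewrite mxE.
- apply: Ck_bigsum => // l _; apply: CkM => //; first exact: (hx l).2.
  move=> t Wt; apply: continuous_comp; first exact: cx.
  exact/(hf l)/WD.
Qed.

(** * The iterated integral over a box *)

(** The mean value theorem bounds a first-order remainder by the oscillation of the derivative. The
    condition is put on a ball about [a], so that [b] may lie on either side. *)
Lemma abs_MVT_le (R : realType) (f df : R -> R) (a b c e : R) :
  (forall x, `|x - a| <= `|b - a| ->
    is_derive x 1 f (df x) /\ `|df x - c| <= e) ->
  `|f b - f a - (b - a) * c| <= e * `|b - a|.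
Proof.
move=> h.
have key (p q : R) : p <= q -> (forall x : R, x \in `[p, q] -> is_derive x 1 f (df x) /\ `|df x - c| <= e) ->
    `|f q - f p - (q - p) * c| <= e * `|q - p|.
  move=> pq hx.
  have hd x : x \in `]p, q[ -> is_derive x 1 f (df x).
    by move=> /subset_itv_oo_cc /hx[].
  have hc : {within `[p, q], continuous f}.
    by apply: derivable_within_continuous => x /hx[[]].
  have [x /hx[_ le_e] ->] := MVT_segment pq hd hc.
  by rewrite [df x * _]mulrC -mulrBr normrM mulrC ler_wpM2r.
have [ab|ba] := leP a b.
  apply: key => // x; rewrite in_itv /= => /andP[ax xb]; apply: h.
  by rewrite !ger0_norm ?subr_ge0// lerD2r.
rewrite -normrN [`|b - a|]distrC.
rewrite (_ : - (_ - _ - _) = f a - f b - (a - b) * c); last by ring.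
apply: key (ltW ba) _ => x; rewrite in_itv /= => /andP[bx xa]; apply: h.
by rewrite distrC [leRHS]distrC !ger0_norm ?subr_ge0 ?(ltW ba)// lerD2l lerN2.
Qed.

(** Fermat's criterion: a negative slope is refuted by the difference quotient at [r / 2], a
    positive one by that at [- (r / 2)]. *)
Lemma is_derive_min0 (R : realType) (F : R -> R) (c l : R) :
  is_derive c 1 F l -> (\forall s \near c, F c <= F s) -> l = 0.
Proof.
move=> [dF <-] hmin.
have cv : h^-1 *: (F (h *: 1 + c) - F c) @[h --> 0^'] --> 'D_1 F c by exact: dF.
have nmin : \forall h \near 0^', F c <= F (h *: 1 + c).
  apply: nbhs_dnbhs; move: hmin; rewrite (near_shift 0).
  by apply: filterS => h; rewrite /= subr0 [h%:A]mulr1.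
apply/eqP; case: ltgtP => // [l0|l0]; exfalso.
- have := cvgr_lt _ cv _ l0 => /(_ _).
  move=> /(filterI nmin)[r /= r0 hr].
  have := hr (r / 2); rewrite /= sub0r normrN gtr0_norm ?divr_gt0// ltr_pdivrMr//.
  rewrite ltr_pMr// ltr1n gt_eqF ?divr_gt0// => /(_ isT isT)[le0].
  by apply/negP; rewrite -leNgt mulr_ge0 ?invr_ge0 ?divr_ge0 ?(ltW r0)// subr_ge0.
- have := cvgr_gt _ cv _ l0 => /(_ _).
  move=> /(filterI nmin)[r /= r0 hr].
  have := hr (- (r / 2)); rewrite /= sub0r opprK gtr0_norm ?divr_gt0// ltr_pdivrMr//.
  rewrite ltr_pMr// ltr1n oppr_eq0 gt_eqF ?divr_gt0// => /(_ isT isT)[le0].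
  apply/negP; rewrite -leNgt mulr_le0_ge0// ?subr_ge0//.
  by rewrite invr_le0 oppr_le0 divr_ge0// ltW.
Qed.

Lemma is_derive_of_dist_le (R : realType) (F : R -> R) (c l : R) :
  (forall d, 0 < d -> \forall e \near c, `|F e - F c - (e - c) * l| <= d * `|e - c|) ->
  is_derive c 1 F l.
Proof.
move=> h.
have cv : h^-1 *: (F (h *: 1 + c) - F c) @[h --> 0^'] --> l.
  apply/cvgrPdist_le => /= d d0.
  have hd : \forall k \near 0^', `|F (k *: 1 + c) - F c - k * l| <= d * `|k|.
    apply: nbhs_dnbhs; have := h d d0; rewrite (near_shift 0).
    by apply: filterS => k; rewrite /= subr0 [k%:A]mulr1 addrK.
  have k0 : \forall k \near 0^', k != 0 :> R by exact: nbhs_dnbhs_neq.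
  apply: filterS2 hd k0 => k hk k0; rewrite distrC.
  have -> : k^-1 *: (F (k%:A + c) - F c) - l = k^-1 * (F (k%:A + c) - F c - k * l).
    by rewrite mulrBr mulrA mulVf// mul1r.
  by rewrite normrM normfV ler_pdivrMl ?normr_gt0// [leRHS]mulrC.
apply: DeriveDef; last exact: (cvg_lim _ cv).
by apply/cvg_ex; exists l.
Qed.

Section BoxCons.
Context {R : realType} {q : nat}.

(** The point at which [box_integral] evaluates its integrand after peeling off one variable, so
    that the integral unfolds to it by conversion. The annotation reconciles [1 + q] with [q.+1]. *)
Definition box_cons (s : R) (t : 'rV[R]_q) : 'rV[R]_q.+1 :=
  row_mx s%:M t : 'rV[R]_(1 + q).

Lemma box_cons0 s t : box_cons s t 0 ord0 = s.
Proof.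
rewrite /box_cons (_ : ord0 = lshift q (0 : 'I_1)); last exact: val_inj.
by rewrite (@row_mxEl _ _ 1) mxE eqxx.
Qed.

Lemma box_consS s t j : box_cons s t 0 (lift ord0 j) = t 0 j.
Proof.
rewrite /box_cons (_ : lift ord0 j = rshift 1 j); last exact: val_inj.
by rewrite (@row_mxEr _ _ 1).
Qed.

Lemma rsubmxS (tau : 'rV[R]_q.+1) j :
  rsubmx (tau : 'rV[R]_(1 + q)) 0 j = tau 0 (lift ord0 j).
Proof. by rewrite mxE; congr (tau _ _); exact: val_inj. Qed.

Lemma box_consP (tau : 'rV[R]_q.+1) s t :
  box tau (box_cons s t) <->
  0 <= s <= tau 0 ord0 /\ box (rsubmx (tau : 'rV[R]_(1 + q))) t.
Proof.
split=> [h|[h0 h] a].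
  split; first by have := h ord0; rewrite box_cons0.
  by move=> a; have := h (lift ord0 a); rewrite box_consS rsubmxS.
have [j ->|->] := unliftP ord0 a; last by rewrite box_cons0.
by rewrite box_consS -rsubmxS.
Qed.

Lemma box_cons_split (t : 'rV[R]_q.+1) :
  t = box_cons (t 0 ord0) (rsubmx (t : 'rV[R]_(1 + q))).
Proof.
apply/rowP => a; have [j ->|->] := unliftP ord0 a; last by rewrite box_cons0.
by rewrite box_consS rsubmxS.
Qed.

Lemma cvg_box_cons (T : Type) (F : set_system T) (FF : Filter F)
    (s : T -> R) (t : T -> 'rV[R]_q) (s0 : R) (t0 : 'rV[R]_q) :
  s x @[x --> F] --> s0 -> t x @[x --> F] --> t0 ->
  box_cons (s x) (t x) @[x --> F] --> box_cons s0 t0.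
Proof.
move=> hs ht; apply: cvg_matrix => i j; rewrite ord1.
have [k ->|->] := unliftP ord0 j.
  rewrite box_consS; under eq_cvg do rewrite box_consS.
  exact: (cvg_comp t (fun v : 'rV[R]_q => v 0 k) ht (@coord_continuous _ _ _ 0 k t0)).
by rewrite box_cons0; under eq_cvg do rewrite box_cons0.
Qed.

End BoxCons.

Section Clamp.
Context {R : realType} {q : nat}.
Implicit Types (tau t : 'rV[R]_q).

Definition clamp tau t : 'rV[R]_q :=
  \row_a Num.max 0 (Num.min (tau 0 a) (t 0 a)).

Lemma clamp_box tau t : (forall a, 0 <= tau 0 a) -> box tau (clamp tau t).
Proof.
by move=> h a; rewrite mxE le_max lexx /= ge_max h ge_min lexx.
Qed.

Lemma clamp_id tau t : box tau t -> clamp tau t = t.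
Proof.
by move=> h; apply/rowP => a; rewrite mxE; have /andP[? ?] := h a; rewrite min_r// max_r.
Qed.

Lemma clamp_continuous tau : continuous (clamp tau).
Proof.
move=> t; apply: (@cvg_matrix _ _ (nbhs t)) => i j; rewrite mxE.
under eq_cvg do rewrite mxE.
apply: (@continuous_max _ _ (fun=> 0) (fun t => Num.min (tau 0 j) (t 0 j))).
  exact: cst_continuous.
apply: (@continuous_min _ _ (fun=> tau 0 j) (fun t => t 0 j)).
  exact: cst_continuous.
exact: coord_continuous.
Qed.

Lemma box_compact tau : compact (box tau).
Proof.
have := @rV_compact R q (fun a => `[0, tau 0 a]%classic) (fun=> @segment_compact _ _ _).
congr compact; apply/seteqP; split=> t h a; have := h a; rewrite /= in_itv//.
Qed.

End Clamp.

Section BoxIntegral.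
Context {R : realType}.
Notation mu := (@lebesgue_measure R).

Lemma box_integralS q (tau : 'rV[R]_q.+1) f :
  box_integral tau f = \int[mu]_(s in `[0, tau 0 ord0])
    box_integral (rsubmx (tau : 'rV[R]_(1 + q))) (fun t => f (box_cons s t)).
Proof. by []. Qed.

Lemma box_integral0 q (tau : 'rV[R]_q) : box_integral tau (fun=> 0) = 0.
Proof.
elim: q tau => [|q IH] tau //; rewrite box_integralS.
transitivity (\int[mu]_(s in `[0, tau 0 ord0]) (0 : R)).
  by apply: eq_Rintegral => s _; exact: IH.
by rewrite Rintegral_cst// mul0r.
Qed.

Lemma box_integral1_ge0 q (tau : 'rV[R]_q) : 0 <= box_integral tau (fun=> 1).
Proof.
elim: q tau => [|q IH] tau; first exact: ler01.
by rewrite box_integralS; apply: Rintegral_ge0 => s _; exact: IH.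
Qed.

Lemma eq_box_integral q (tau : 'rV[R]_q) f g :
  (forall t, box tau t -> f t = g t) -> box_integral tau f = box_integral tau g.
Proof.
elim: q tau f g => [|q IH] tau f g fg /=; first by apply: fg => -[].
apply: eq_Rintegral => s; rewrite inE /= in_itv /= => hs.
by apply: IH => t ht; apply: fg; apply/box_consP.
Qed.

Lemma continuous_integrable_itv (G : R -> R) a b : continuous G ->
  mu.-integrable `[a, b] (EFin \o G).
Proof.
move=> cG; apply: continuous_compact_integrable; first exact: segment_compact.
exact: continuous_subspaceT.
Qed.

(** This and [box_monotone] are named predicates of the dimension because they must be proved
    together: dimension q + 1 requires the inner integral to be continuous in the outer variable,
    and that continuity is derived from both properties in dimension q. *)
Definition box_linear q := forall (tau : 'rV[R]_q) (a : R)
    (f g : 'rV[R]_q -> R),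
  continuous f -> continuous g ->
  box_integral tau (fun t => a * f t + g t) =
  a * box_integral tau f + box_integral tau g.

Definition box_monotone q := forall (tau : 'rV[R]_q)
    (f g : 'rV[R]_q -> R),
  continuous f -> continuous g -> (forall t, box tau t -> f t <= g t) ->
  box_integral tau f <= box_integral tau g.

Lemma box_integral_dist_le q (tau : 'rV[R]_q) (f g : 'rV[R]_q -> R) (e : R) :
  box_linear q -> box_monotone q -> continuous f -> continuous g ->
  (forall t, box tau t -> `|f t - g t| <= e) ->
  `|box_integral tau f - box_integral tau g| <= e * box_integral tau (fun=> 1).
Proof.
move=> L Mo cf cg fg.
have c1 : continuous (fun _ : 'rV[R]_q => 1 : R) by exact: cst_continuous.
have key (f1 f2 : 'rV[R]_q -> R) : continuous f1 -> continuous f2 ->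
    (forall t, box tau t -> f1 t <= e + f2 t) ->
    box_integral tau f1 - box_integral tau f2 <= e * box_integral tau (fun=> 1).
  move=> h1 h2 le12; rewrite lerBlDr -L//; apply: Mo => //.
    by move=> t; exact: (@cvgD _ _ _ (nbhs t) _ (fun=> e * 1) f2 _ _ (cvg_cst _) (h2 t)).
  by move=> t /le12; rewrite mulr1.
rewrite ler_norml; apply/andP; split.
  rewrite lerNl opprB; apply: key => // t /fg.
  by rewrite distrC -lerBlDr; apply: le_trans; exact: ler_norm.
apply: key => // t /fg.
by rewrite -lerBlDr; apply: le_trans; exact: ler_norm.
Qed.

(** Joint continuity and compactness of the box make [f s] uniformly close to [f s0] on the box for
    s near [s0]; integrating costs a factor equal to the volume. *)
Lemma box_integral_param_continuous q (tau : 'rV[R]_q) (f : R -> 'rV[R]_q -> R) :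
  box_linear q -> box_monotone q -> continuous (fun z : R * 'rV[R]_q => f z.1 z.2) ->
  continuous (fun s => box_integral tau (f s)).
Proof.
move=> L Mo cf s0.
have cfs s : continuous (f s).
  move=> t; exact: (@continuous2_cvg _ _ _ _ (nbhs t) _ (fun=> s) id f s t
    (cf (s, t)) (cvg_cst _) cvg_id).
apply/cvgrPdist_le => /= e e0.
set v := box_integral tau (fun=> 1).
have v0 : 0 <= v by exact: box_integral1_ge0.
(* The volume [v] may be 0, hence the [+ 1] in the divisor. *)
pose e' := e / (v + 1).
have e'0 : 0 < e' by rewrite divr_gt0// ltr_wpDl.
have : \forall s \near s0, box tau `<=` (fun t => `|f s0 t - f s t| <= e').
  apply: ((compact_near_coveringP (box tau)).1 (@box_compact _ _ tau) R (nbhs s0)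
    (fun s t => `|f s0 t - f s t| <= e') _) => t _.
  have cv : (fun z : 'rV[R]_q * R => f s0 z.1 - f z.2 z.1) z @[z --> (t, s0)] --> f s0 t - f s0 t.
    apply: cvgB.
      exact: (@cvg_comp _ _ _ fst (f s0) (nbhs (t, s0)) (nbhs t) _ cvg_fst (cfs s0 t)).
    exact: (@continuous2_cvg _ _ _ _ (nbhs (t, s0)) _ snd fst f s0 t
      (cf (s0, t)) cvg_snd cvg_fst).
  rewrite subrr in cv.
  by have /(_ _) h := (cvgr0Pnorm_le _).1 cv e' e'0; exact: h.
move=> h; apply: filterS h => s hs.
apply: le_trans (box_integral_dist_le L Mo (cfs s0) (cfs s) hs) _.
rewrite /e' -/v mulrAC ler_pdivrMr ?ltr_wpDl// ler_wpM2l ?(ltW e0)//.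
by rewrite lerDl.
Qed.

Lemma continuous_box_cons q (f : 'rV[R]_q.+1 -> R) : continuous f ->
  continuous (fun z : R * 'rV[R]_q => f (box_cons z.1 z.2)).
Proof.
move=> cf z; have h : box_cons z'.1 z'.2 @[z' --> z] --> box_cons z.1 z.2.
  by apply: cvg_box_cons; [exact: cvg_fst | exact: cvg_snd].
exact: (cvg_comp _ _ h (cf _)).
Qed.

Lemma continuous_box_consr q (f : 'rV[R]_q.+1 -> R) s : continuous f ->
  continuous (fun t => f (box_cons s t)).
Proof.
move=> cf t; have h : box_cons s t' @[t' --> t] --> box_cons s t.
  exact: (@cvg_box_cons _ _ _ (nbhs t) _ (fun=> s) id _ _ (cvg_cst _) cvg_id).
exact: (cvg_comp _ _ h (cf _)).
Qed.

Lemma box_linear_monotone q : box_linear q /\ box_monotone q.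
Proof.
elim: q => [|q [L Mo]].
  by split=> [tau a f g _ _|tau f g _ _] //= h; apply: h; case.
have cI (tau : 'rV[R]_q) (f : 'rV[R]_q.+1 -> R) : continuous f ->
    continuous (fun s => box_integral tau (fun t => f (box_cons s t))).
  move=> cf; apply: (box_integral_param_continuous (f := fun s t => f (box_cons s t))) => //.
  exact: continuous_box_cons.
split=> [tau a f g cf cg|tau f g cf cg fg].
- rewrite !box_integralS.
  transitivity (\int[mu]_(s in `[0, tau 0 ord0])
      (a * box_integral (rsubmx (tau : 'rV[R]_(1 + q))) (fun t => f (box_cons s t)) +
       box_integral (rsubmx (tau : 'rV[R]_(1 + q))) (fun t => g (box_cons s t)))).
    by apply: eq_Rintegral => s _; rewrite L//; exact: continuous_box_consr.
  have iF := continuous_integrable_itv 0 (tau 0 ord0) (cI (rsubmx (tau : 'rV[R]_(1 + q))) f cf).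
  have iG := continuous_integrable_itv 0 (tau 0 ord0) (cI (rsubmx (tau : 'rV[R]_(1 + q))) g cg).
  rewrite RintegralD ?RintegralZl//.
  apply: continuous_integrable_itv => s.
  exact: (@cvgM _ _ (nbhs s) _ (fun=> a) _ _ _ (cvg_cst _) (cI _ _ cf s)).
- rewrite !box_integralS; apply: le_Rintegral => //.
  + exact: continuous_integrable_itv (cI _ _ cf).
  + exact: continuous_integrable_itv (cI _ _ cg).
  + move=> s; rewrite /= in_itv /= => hs; apply: Mo; [exact: continuous_box_consr..|].
    by move=> t ht; apply: fg; apply/box_consP.
Qed.

(* Functions only continuous at the points of the box are handled by
   composition with the retraction onto the box. *)
Definition box_continuous q (tau : 'rV[R]_q) (f : 'rV[R]_q -> R) :=
  forall t, box tau t -> {for t, continuous f}.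

Section OnBox.
Context {q : nat} {tau : 'rV[R]_q}.
Hypothesis tau_ge0 : forall a, 0 <= tau 0 a.
Implicit Types f g : 'rV[R]_q -> R.

Let continuous_clamp f : box_continuous tau f -> continuous (f \o clamp tau).
Proof.
move=> cf t; apply: continuous_comp; first exact: clamp_continuous.
exact/cf/clamp_box.
Qed.

Let box_integral_clamp f :
  box_integral tau f = box_integral tau (f \o clamp tau).
Proof. by apply: eq_box_integral => t ht /=; rewrite clamp_id. Qed.

Lemma box_integral_linear a f g : box_continuous tau f -> box_continuous tau g ->
  box_integral tau (fun t => a * f t + g t) =
  a * box_integral tau f + box_integral tau g.
Proof.
move=> cf cg; rewrite [LHS]box_integral_clamp (box_integral_clamp f)
  (box_integral_clamp g) -(box_linear_monotone q).1//; exact: continuous_clamp.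
Qed.

Lemma box_integral_dist f g e : box_continuous tau f -> box_continuous tau g ->
  (forall t, box tau t -> `|f t - g t| <= e) ->
  `|box_integral tau f - box_integral tau g| <= e * box_integral tau (fun=> 1).
Proof.
move=> cf cg fg; rewrite (box_integral_clamp f) (box_integral_clamp g).
have [L Mo] := box_linear_monotone q.
apply: box_integral_dist_le => //; [exact: continuous_clamp..|].
by move=> t _; apply: fg; exact: clamp_box.
Qed.

(** Near each point of the box the derivative in the parameter stays within [d] of its value at
    [e0], so the mean value theorem bounds the remainder there; compactness then gives one
    neighbourhood of [e0] for the whole box. *)
Let box_integral_uniform (Phi DPhi : R -> 'rV[R]_q -> R) (e0 d : R) : 0 < d ->
  (forall t, box tau t -> \forall t' \near t & e \near e0,
    is_derive (e : R) 1 (Phi ^~ t') (DPhi e t')) ->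
  (forall t, box tau t ->
    DPhi z.2 z.1 @[z --> (t, e0)] --> DPhi e0 t) ->
  \forall e \near e0, box tau `<=`
    (fun t => `|Phi e t - Phi e0 t - (e - e0) * DPhi e0 t| <= d * `|e - e0|).
Proof.
move=> d0 hd hc.
apply: ((compact_near_coveringP (box tau)).1 (@box_compact _ _ tau) R (nbhs e0)
  (fun e t => `|Phi e t - Phi e0 t - (e - e0) * DPhi e0 t| <= d * `|e - e0|) _).
move=> t ht; have ht1 := hd t ht.
have cv0 : DPhi e0 z.1 @[z --> (t, e0)] --> DPhi e0 t.
  have h1 : (z.1, e0) @[z --> (t, e0)] --> (t, e0).
    by apply: (@cvg_pair _ _ _ (nbhs (t, e0)) (nbhs t) (nbhs e0)); [exact: cvg_fst | exact: cvg_cst].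
  exact: (@cvg_comp _ _ _ _ (fun z => DPhi z.2 z.1) _ _ _ h1 (hc t ht)).
have cv : DPhi z.2 z.1 - DPhi e0 z.1 @[z --> (t, e0)] --> 0.
  by rewrite -[0](subrr (DPhi e0 t)); exact: cvgB (hc t ht) cv0.
have /(_ _) h := (cvgr0Pnorm_le _).1 cv d d0.
have [[A B] /= [nA nB] AB] := filterI ht1 h.
have [r /= r0 rB] := (nbhs_ballP _ _).1 nB.
(* Shrinking to a ball ensures that every parameter between [e0] and [e] is covered, as the mean
   value estimate demands. *)
exists (A, ball e0 r); first by split=> //; exact: nbhsx_ballx.
move=> [s e] /= [As e0e].
apply: (@abs_MVT_le _ (Phi^~ s) (DPhi^~ s)) => x xe.
have Bx : B x.
  apply: rB; move: e0e; rewrite -!ball_normE /= distrC => e0e.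
  by rewrite distrC; exact: le_lt_trans xe e0e.
by have [] := AB (s, x) (conj As Bx).
Qed.

(** Differentiation under the integral without dominated convergence: the remainder of the integrand
    is o(e - e0) uniformly on the box, and integration multiplies the bound by at most the
    volume. *)
Lemma is_derive_box_integral (Phi DPhi : R -> 'rV[R]_q -> R) (e0 : R) :
  (forall t, box tau t -> \forall t' \near t & e \near e0,
    is_derive (e : R) 1 (Phi ^~ t') (DPhi e t')) ->
  (forall t, box tau t ->
    DPhi z.2 z.1 @[z --> (t, e0)] --> DPhi e0 t) ->
  (\forall e \near e0, box_continuous tau (Phi e)) ->
  is_derive e0 1 (fun e => box_integral tau (Phi e)) (box_integral tau (DPhi e0)).
Proof.
move=> hd hc hP; apply: is_derive_of_dist_le => d d0.
have cD : box_continuous tau (DPhi e0).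
  move=> t ht; have h1 : (t', e0) @[t' --> t] --> (t, e0).
    by apply: (@cvg_pair _ _ _ (nbhs t) (nbhs t) (nbhs e0)); [exact: cvg_id | exact: cvg_cst].
  exact: (@cvg_comp _ _ _ _ (fun z => DPhi z.2 z.1) _ _ _ h1 (hc t ht)).
set v := box_integral tau (fun=> 1).
have v0 : 0 <= v by exact: box_integral1_ge0.
have v1 : 0 < v + 1 by rewrite ltr_wpDl.
have hu := box_integral_uniform (divr_gt0 d0 v1) hd hc.
have cP0 := nbhs_singleton hP.
apply: filterS2 hu hP => e hu cPe.
have cg : box_continuous tau (fun t => (e - e0) * DPhi e0 t + Phi e0 t).
  move=> t ht; exact: (@cvgD _ _ _ (nbhs t) _ (fun t => (e - e0) * DPhi e0 t) _ _ _
    (@cvgM _ _ (nbhs t) _ (fun=> e - e0) _ _ _ (cvg_cst _) (cD t ht)) (cP0 t ht)).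
have -> : box_integral tau (Phi e) - box_integral tau (Phi e0)
   - (e - e0) * box_integral tau (DPhi e0) = box_integral tau (Phi e) -
   box_integral tau (fun t => (e - e0) * DPhi e0 t + Phi e0 t).
  by rewrite box_integral_linear// opprD [RHS]addrA addrAC.
apply: le_trans (box_integral_dist cPe cg (e := d / (v + 1) * `|e - e0|) _) _.
  by move=> t /hu; rewrite opprD addrA addrAC.
rewrite -/v -mulrA [_ * v]mulrC mulrA ler_wpM2r// mulrAC ler_pdivrMr//.
by rewrite ler_wpM2l ?(ltW d0)// lerDl.
Qed.

End OnBox.

End BoxIntegral.

(** * Vanishing integrals: nonnegative integrands, and derivatives of functions supported in the
    box *)

Section Vanishing.
Context {R : realType}.
Notation mu := (@lebesgue_measure R).

(** A positive value at [s0] would keep [G] above half of it on an interval of positive length,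
    making the integral positive. *)
Lemma Rintegral_itv_eq0 (G : R -> R) (a : R) : 0 < a -> continuous G ->
  (forall s, 0 <= s <= a -> 0 <= G s) -> \int[mu]_(s in `[0, a]) G s = 0 ->
  forall s, 0 <= s <= a -> G s = 0.
Proof.
move=> a0 cG G0 intG s0 s0a; apply/eqP; rewrite eq_le G0// andbT leNgt.
apply/negP => Gs0.
have /cvgrPdist_lt /(_ (G s0 / 2)) := cG s0.
rewrite divr_gt0// => /(_ isT) /(nbhs_ballP _ _).1 [r /= r0 hr].
(* The interval about [s0] is clipped to [[0, a]]; as [0 < a] it keeps positive length even when
   [s0] is an endpoint. *)
pose c := Num.max 0 (s0 - r / 2); pose d := Num.min a (s0 + r / 2).
have /andP[s00 s0a'] := s0a.
have r20 : 0 < r / 2 by rewrite divr_gt0.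
have cd : c < d.
  rewrite /c /d gt_max !lt_min a0 /=; apply/andP; split; first by lra.
  by apply/andP; split; lra.
have sub : `[c, d] `<=` `[0, a].
  move=> s; rewrite /= !in_itv /= => /andP[cs sd].
  by move: cs sd; rewrite /c /d ge_max le_min => /andP[-> _] /andP[-> _].
have big s : `[c, d]%classic s -> G s0 / 2 <= G s.
  rewrite /= in_itv /= /c /d ge_max le_min => /andP[/andP[_ h1] /andP[_ h2]].
  have : `|G s0 - G s| < G s0 / 2.
    apply: hr; rewrite -ball_normE /= ltr_norml; apply/andP; split; lra.
  by rewrite ltr_norml => /andP[]; lra.
have cst_int : mu.-integrable `[c, d] (EFin \o (fun=> G s0 / 2)).
  by apply: continuous_integrable_itv; exact: cst_continuous.
have h1 : \int[mu]_(s in `[c, d]) (G s0 / 2) <= \int[mu]_(s in `[c, d]) G s.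
  by apply: le_Rintegral => //; exact: continuous_integrable_itv.
have h2 : \int[mu]_(s in `[c, d]) G s <= \int[mu]_(s in `[0, a]) G s.
  apply: fine_le.
  - by apply: integrable_fin_num => //; exact: continuous_integrable_itv.
  - by apply: integrable_fin_num => //; exact: continuous_integrable_itv.
  - apply: ge0_subset_integral => //.
      exact: (measurable_int _ (continuous_integrable_itv 0 a cG)).
have := le_trans h1 h2.
rewrite intG Rintegral_cst//= lebesgue_measure_itv /= lte_fin cd -EFinD /=.
by apply/negP; rewrite -ltNge mulr_gt0 ?divr_gt0// subr_gt0.
Qed.

Lemma box_integral_continuous q (tau : 'rV[R]_q.+1) (f : 'rV[R]_q.+1 -> R) :
  continuous f -> continuous (fun s =>
    box_integral (rsubmx (tau : 'rV[R]_(1 + q))) (fun t => f (box_cons s t))).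
Proof.
move=> cf; have [L Mo] := box_linear_monotone (R := R) q.
apply: (box_integral_param_continuous (f := fun s t => f (box_cons s t))) => //.
exact: continuous_box_cons.
Qed.

Lemma box_integral_ge0 q (tau : 'rV[R]_q) f : (forall t, box tau t -> 0 <= f t) ->
  0 <= box_integral tau f.
Proof.
elim: q tau f => [|q IH] tau f h /=; first by apply: h; case.
apply: Rintegral_ge0 => s; rewrite /= in_itv /= => hs; apply: IH => t ht.
by apply: h; apply/box_consP.
Qed.

(** The inner integral is a continuous nonnegative function of the first coordinate, so it vanishes
    on every slice by the one-dimensional case, and induction applies to the slice. *)
Lemma box_integral_eq0 q (tau : 'rV[R]_q) (f : 'rV[R]_q -> R) : (forall a, 0 < tau 0 a) ->
  continuous f -> (forall t, box tau t -> 0 <= f t) -> box_integral tau f = 0 ->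
  forall t, box tau t -> f t = 0.
Proof.
elim: q tau f => [|q IH] tau f tau0 cf f0 If t ht.
  by rewrite -[RHS]If /=; congr f; apply/rowP => -[].
have tau0' a : 0 < rsubmx (tau : 'rV[R]_(1 + q)) 0 a by rewrite rsubmxS.
move: ht; rewrite (box_cons_split t) => /box_consP[hs ht].
apply: (IH _ (fun t => f (box_cons _ t)) tau0' _ _ _ _ ht).
- exact: continuous_box_consr.
- by move=> t' ht'; apply: f0; apply/box_consP.
have key := @Rintegral_itv_eq0 (fun s => box_integral (rsubmx (tau : 'rV[R]_(1 + q)))
  (fun t => f (box_cons s t))) _ (tau0 ord0) (box_integral_continuous (tau := tau) cf).
apply: key hs.
- move=> s hs'; apply: box_integral_ge0 => t' ht'.
  by apply: f0; apply/box_consP.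
- by rewrite -box_integralS.
Qed.

Lemma is_derive_box_cons q (h : 'rV[R]_q.+1 -> R) (s : R) t :
  differentiable h (box_cons s t) ->
  is_derive s 1 (fun s => h (box_cons s t)) (pd ord0 h (box_cons s t)).
Proof.
move=> dh.
have key i : is_derive s 1 (fun s => box_cons s t 0 i) ((delta_mx 0 ord0 : 'rV[R]_q.+1) 0 i).
  rewrite mxE eqxx /=; have [j ->|->] := unliftP ord0 i.
    rewrite (_ : (fun _ => _) = cst (t 0 j)); first exact: is_derive_cst.
    by apply/funext => s'; rewrite box_consS.
  rewrite (_ : (fun _ => _) = id); first exact: is_derive_id.
  by apply/funext => s'; rewrite box_cons0.
have := is_derive_comp key dh.
rewrite (bigD1 ord0)//= mxE !eqxx mul1r big1 ?addr0// => i i0.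
by rewrite mxE (negbTE i0) andbF mul0r.
Qed.

Lemma pd_box_cons q (h : 'rV[R]_q.+1 -> R) s t a :
  differentiable h (box_cons s t) ->
  pd a (fun t => h (box_cons s t)) t = pd (lift ord0 a) h (box_cons s t).
Proof.
move=> dh.
have key i : is_derive t (delta_mx 0 a) (fun t => box_cons s t 0 i)
    ((delta_mx 0 (lift ord0 a) : 'rV[R]_q.+1) 0 i).
  rewrite mxE eqxx /=; have [j ->|->] := unliftP ord0 i.
    under eq_fun do rewrite box_consS.
    have := is_derive_entry t (delta_mx 0 a) 0 j.
    by rewrite mxE (inj_eq lift_inj).
  rewrite (_ : (fun _ => _) = cst s); first exact: is_derive_cst.
  by apply/funext => s'; rewrite box_cons0.
have hd := is_derive_comp key dh.
rewrite [LHS](@derive_val _ _ _ _ _ _ _ hd).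
rewrite (bigD1 (lift ord0 a))//= mxE !eqxx mul1r big1 ?addr0// => i i0.
by rewrite mxE (negbTE i0) andbF mul0r.
Qed.

(** Integration by parts with no boundary term. A derivative in a later coordinate is handled slice
    by slice, since slices of [h] also vanish off their open box; only the first coordinate calls
    for the fundamental theorem of calculus. *)
Lemma box_integral_pd q (tau : 'rV[R]_q) (h : 'rV[R]_q -> R) (a : 'I_q) :
  (forall b, 0 < tau 0 b) -> Ck 1 setT h ->
  (forall t : 'rV[R]_q, ~ (forall b, 0 < t 0 b < tau 0 b) -> h t = 0) ->
  box_integral tau (pd a h) = 0.
Proof.
elim: q tau h a => [|q IH] tau h a tau0 Ch h0; first by case: a.
have [dh ch] := Ch.
have tau0' b : 0 < rsubmx (tau : 'rV[R]_(1 + q)) 0 b by rewrite rsubmxS.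
have chd : continuous h by move=> t; apply: differentiable_continuous; exact: dh.
have [a' ->|->] := unliftP ord0 a.
  rewrite box_integralS.
  transitivity (\int[mu]_(s in `[0, tau 0 ord0]) (0 : R)); last first.
    by rewrite Rintegral_cst// mul0r.
  apply: eq_Rintegral => s _.
  rewrite -[RHS](IH (rsubmx (tau : 'rV[R]_(1 + q))) (fun t => h (box_cons s t)) a' tau0').
  - by apply: eq_box_integral => t _; rewrite pd_box_cons//; exact: dh.
  - apply: (@C1_comp _ _ _ _ setT h (box_cons s) openT) => // i.
    have [j ->|->] := unliftP ord0 i.
      by under eq_fun do rewrite box_consS; exact: Ck_coord.
    by under eq_fun do rewrite box_cons0; exact: Ck_cst.
  - move=> t nt; apply: h0 => hb; apply: nt => b.
    by have := hb (lift ord0 b); rewrite box_consS rsubmxS.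
(* For the first coordinate, [g] is the derivative of [G] under the inner integral, and [G] vanishes
   at both ends of the interval. *)
pose G s := box_integral (rsubmx (tau : 'rV[R]_(1 + q))) (fun t => h (box_cons s t)).
pose g s := box_integral (rsubmx (tau : 'rV[R]_(1 + q))) (fun t => pd ord0 h (box_cons s t)).
have cpd : continuous (pd ord0 h) by move=> t; exact: ch.
have dG (s : R) : is_derive s 1 G (g s).
  apply: (is_derive_box_integral (fun a => ltW (tau0' a))
     (Phi := fun s t => h (box_cons s t)) (DPhi := fun s t => pd ord0 h (box_cons s t))).
  - by move=> t _; near=> t' e; apply: is_derive_box_cons; exact: dh.
  - move=> t _; have hc : box_cons z.2 z.1 @[z --> (t, s)] --> box_cons s t.
      by apply: cvg_box_cons; [exact: cvg_snd | exact: cvg_fst].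
    exact: (cvg_comp _ _ hc (cpd _)).
  - by near=> e; move=> t _; exact: continuous_box_consr.
have cg : continuous g by exact: box_integral_continuous.
have cG : continuous G by exact: box_integral_continuous.
have zero s : ~ (0 < s < tau 0 ord0) -> G s = 0.
  move=> hs; rewrite -[RHS](box_integral0 (rsubmx (tau : 'rV[R]_(1 + q)))).
  apply: eq_box_integral => t _; apply: h0 => hb; apply: hs.
  by have := hb ord0; rewrite box_cons0.
rewrite box_integralS -/(g _) /Rintegral.
rewrite (@continuous_FTC2 _ g G)//.
- by rewrite !zero ?ltxx ?andbF//= subrr.
- exact: continuous_subspaceT.
- split=> [x _||]; first by have [] := dG x.
  + apply: cvg_at_right_filter; exact: cG.
  + apply: cvg_at_left_filter; exact: cG.
- by move=> x _; rewrite derive1E derive_val.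
Unshelve. all: by end_near. Qed.

End Vanishing.

(** * The area integrand *)

Section PositiveDeterminant.
Context {R : realType}.

Lemma mulmx_tr_gt0 p (w : 'rV[R]_p) : w != 0 -> 0 < (w *m w^T) 0 0.
Proof.
move=> w0; have [i wi] : exists i, w 0 i != 0.
  by apply/existsP; apply: contraNT w0; rewrite negb_exists => /forallP h;
    apply/eqP/rowP => i; rewrite mxE; apply/eqP; rewrite -[_ == _]negbK; exact: h.
rewrite mxE (bigD1 i)//= mxE; apply: ltr_pwDl.
  by rewrite -expr2 exprn_even_gt0.
by apply: sumr_ge0 => j _; rewrite mxE -expr2 sqr_ge0.
Qed.

(* The determinant cannot change sign along the segment from the identity. *)
Lemma det_posdef_gt0 p (A : 'M[R]_p) :
  (forall w : 'rV[R]_p, w != 0 -> 0 < (w *m A *m w^T) 0 0) -> 0 < \det A.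
Proof.
move=> posA; pose f s := \det (s *: A + (1 - s)%:M).
have f_neq0 s : 0 <= s <= 1 -> f s != 0.
  move=> /andP[s0 s1]; apply/negP => /det0P[w w0].
  rewrite mulmxDr -scalemxAr mul_mx_scalar => h.
  have : ((s *: (w *m A) + (1 - s) *: w) *m w^T) 0 0 = 0 by rewrite h mul0mx mxE.
  rewrite mulmxDl -!scalemxAl mxE [X in X + _]mxE [X in _ + X]mxE.
  have := posA w w0; have := mulmx_tr_gt0 w0.
  move: ((w *m A *m w^T) 0 0) ((w *m w^T) 0 0) => a b b0 a0.
  by move=> e; have := s0; rewrite le_eqVlt => /predU1P[s00|s00]; nra.
have cf : continuous f.
  move=> s; apply: (@cvg_det _ _ (nbhs s)) => i j.
  rewrite !mxE; under eq_cvg do rewrite !mxE.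
  apply: cvgD; first by apply: cvgM; [exact: cvg_id | exact: cvg_cst].
  apply: (@cvgMn _ _ _ (nbhs s)); apply: cvgB; [exact: cvg_cst | exact: cvg_id].
have f0 : f 0 = 1 by rewrite /f scale0r add0r subr0 det1.
have f1 : f 1 = \det A by rewrite /f scale1r subrr raddf0 addr0.
rewrite -f1 ltNge; apply/negP => f1le0.
have [||c c01 fc] := @IVT R f 0 1 0 ler01.
- exact: continuous_subspaceT.
- by rewrite f0 ge_min f1le0 orbT le_max ler01.
- by have := f_neq0 c; rewrite fc eqxx => /(_ c01).
Qed.

End PositiveDeterminant.

Lemma mxtrace_delta (R : realType) p q (a : 'I_p) (k : 'I_q) (B : 'M[R]_(q, p)) :
  \tr (delta_mx a k *m B) = B k a.
Proof.
rewrite /mxtrace (bigD1 a)//= big1 => [|b ba].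
  rewrite addr0 mxE (bigD1 k)//= big1 => [|l lk]; first by rewrite mxE !eqxx mul1r addr0.
  by rewrite mxE (negbTE lk) andbF mul0r.
by rewrite mxE big1// => l _; rewrite mxE (negbTE ba) mul0r.
Qed.

Section Area.
Context {R : realType} {m n : nat} {M : riemannian_chart R n}.
Implicit Types (y : 'rV[R]_n) (v : 'M[R]_(m, n)).

Let g := metric M.
Let h := @induced_metric R m n M.

Definition dmetric (k : 'I_n) y : 'M[R]_n := \matrix_(i, j) pd k (fun z => g z i j) y.

(* sqrt(g) g^{ab}, written with the adjugate so that no division by det is needed. *)
Definition cometric y v : 'M[R]_m := (Num.sqrt (\det (h y v)))^-1 *: \adj (h y v).

Lemma metric_differentiable y i j : chart_dom M y -> differentiable (fun z => g z i j) y.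
Proof. by move=> yM; have [+ _] := @metric_smooth R n M i j 1; exact. Qed.

Lemma induced_metric_sym y v : chart_dom M y -> (h y v)^T = h y v.
Proof.
by move=> yM; rewrite /h /induced_metric !trmx_mul trmxK metric_sym// mulmxA.
Qed.

Lemma det_induced_metric_gt0 y v : chart_dom M y -> row_free v -> 0 < \det (h y v).
Proof.
move=> yM fv; apply: det_posdef_gt0 => w w0.
have wv0 : w *m v != 0 by rewrite mulmx_free_eq0.
have := metric_pos yM wv0; rewrite trmx_mul /h /induced_metric.
by rewrite !mulmxA.
Qed.

(** Linear independence of a perturbed control is recovered from positivity of the determinant,
    which is stable under small perturbations. *)
Lemma row_free_det_induced_metric y v : \det (h y v) != 0 -> row_free v.
Proof.
move=> d0; have : h y v \in unitmx by rewrite unitmxE unitfE.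
rewrite -row_free_unit /row_free eqn_leq => /andP[_ r].
rewrite eqn_leq rank_leq_row /=; apply: leq_trans r _.
by rewrite /h /induced_metric -mulmxA mxrankM_maxl.
Qed.

Section Positive.
Context {y : 'rV[R]_n} {v : 'M[R]_(m, n)}.
Hypotheses (yM : chart_dom M y) (det_gt0 : 0 < \det (h y v)).

Lemma induced_metric_unit : h y v \in unitmx.
Proof. by rewrite unitmxE unitfE gt_eqF. Qed.

Lemma cometricE : cometric y v = Num.sqrt (\det (h y v)) *: invmx (h y v).
Proof.
rewrite /cometric /invmx induced_metric_unit scalerA; congr (_ *: _).
rewrite -[X in _ = _ / X](sqr_sqrtr (ltW det_gt0)) expr2 invfM mulrA divff ?mul1r//.
by rewrite gt_eqF// sqrtr_gt0.
Qed.

Lemma invmx_induced_metric_sym : (invmx (h y v))^T = invmx (h y v).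
Proof. by rewrite trmx_inv induced_metric_sym. Qed.

Lemma cometric_sym : (cometric y v)^T = cometric y v.
Proof. by rewrite cometricE linearZ /= invmx_induced_metric_sym. Qed.

(** The two terms are transposes of each other, hence have equal traces against a symmetric [N]. The
    resulting 2 cancels the 1/2 coming from the square root. *)
Lemma mxtrace_variation (N : 'M[R]_m) (dv : 'M[R]_(m, n)) : N^T = N ->
  \tr (N *m (dv *m g y *m v^T + v *m g y *m dv^T)) =
  2 * \tr (dv *m (g y *m v^T *m N)).
Proof.
move=> symN; rewrite mulmxDr linearD /=.
have -> : \tr (N *m (v *m g y *m dv^T)) = \tr (N *m (dv *m g y *m v^T)).
  rewrite -mxtrace_tr !trmx_mul trmxK symN metric_sym// mxtrace_mulC.
  by rewrite !mulmxA.
by rewrite mulr_natl mulr2n; congr (_ + _); rewrite mxtrace_mulC !mulmxA.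
Qed.

End Positive.

(** Jacobi's formula and the chain rule give (1/2) tr(N dh), with N = sqrt(det h) h^-1 and h = U g
    U^T. The variation of g yields the first term, the two variations of U merge into the second.
    Arbitrary [Y] and [U] cover both partial derivatives in the position and derivatives along a
    variation. *)
Lemma is_derive_area (V : normedModType R) (Y : V -> 'rV[R]_n)
    (U : V -> 'M[R]_(m, n)) (dg : 'M[R]_n) (dU : 'M[R]_(m, n)) t d :
  (forall i j, is_derive t d (fun s => g (Y s) i j) (dg i j)) ->
  (forall a i, is_derive t d (fun s => U s a i) (dU a i)) ->
  chart_dom M (Y t) -> 0 < \det (h (Y t) (U t)) ->
  is_derive t d (fun s => Num.sqrt (\det (h (Y s) (U s))))
    (2^-1 * \tr (cometric (Y t) (U t) *m (U t *m dg *m (U t)^T)) +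
     \tr (dU *m (g (Y t) *m (U t)^T *m cometric (Y t) (U t)))).
Proof.
move=> hg hU YM det_gt0.
have hUT i a : is_derive t d (fun s => (U s)^T i a) (dU^T i a).
  by rewrite mxE; under eq_fun do rewrite mxE.
have hdet := is_derive_det (is_derive_mulmx_entry (is_derive_mulmx_entry hU hg) hUT).
have := is_derive_comp1 hdet (is_derive1_sqrt det_gt0).
congr is_derive.
rewrite -/(h (Y t) (U t)) mulmxDl addrAC [_ *m (_ + _)]mulmxDr linearD /=.
have E X : (2 * Num.sqrt (\det (h (Y t) (U t))))^-1 * \tr (\adj (h (Y t) (U t)) *m X) =
    2^-1 * \tr (cometric (Y t) (U t) *m X).
  by rewrite invfM -mulrA -mxtraceZ scalemxAl.
rewrite mulrDr !E [RHS]addrC mxtrace_variation//; last exact: cometric_sym.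
by rewrite mulrA mulVf ?mul1r// pnatr_eq0.
Qed.

(** The derivative of the area density sqrt(det h) in the coordinate y^k, with the velocities held
    fixed. *)
Definition force (k : 'I_n) y v : R :=
  2^-1 * \tr (cometric y v *m (v *m dmetric k y *m v^T)).

(** Entry (i, a) is the derivative of the area density in v^i_a, namely sqrt(g) g_{ij} v^j_b
    g^{ba}. *)
Definition impulse y v : 'M[R]_(n, m) := g y *m v^T *m cometric y v.

Lemma dL_dxE k y v : chart_dom M y -> 0 < \det (h y v) ->
  dL_dx M k y v = - force k y v.
Proof.
move=> yM det_gt0.
have hg i j : is_derive y (delta_mx 0 k) (fun z => g (id z) i j) (dmetric k y i j).
  by rewrite mxE; apply: is_derive_pd; exact: metric_differentiable.
have hv (a : 'I_m) (i : 'I_n) :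
    is_derive y (delta_mx 0 k) (fun=> v a i) ((0 : 'M[R]_(m, n)) a i).
  by rewrite mxE; exact: is_derive_cst.
have := is_derive_area hg hv yM det_gt0.
rewrite mul0mx linear0 addr0 => hd.
have hN := is_deriveN hd.
by rewrite /dL_dx /pd; exact: (@derive_val _ _ _ _ _ _ _ hN).
Qed.

Lemma momentumE i a y v : chart_dom M y -> 0 < \det (h y v) ->
  momentum M i a y v = - impulse y v i a.
Proof.
move=> yM det_gt0; pose X := (delta_mx a i : 'M[R]_(m, n)) *m g y *m v^T + v *m g y *m (delta_mx a i)^T.
have dX b c : 'D_(delta_mx a i) (fun w : 'M[R]_(m, n) => h y w b c) v = X b c.
  have hU b' i' := is_derive_entry v (delta_mx a i) b' i'.
  have hUT i' b' : is_derive v (delta_mx a i) (fun w : 'M[R]_(m, n) => w^T i' b')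
      ((delta_mx a i : 'M[R]_(m, n))^T i' b').
    by rewrite mxE; under eq_fun do rewrite mxE.
  have hg i' j' : is_derive v (delta_mx a i) (fun=> g y i' j') ((0 : 'M[R]_n) i' j').
    by rewrite mxE; exact: is_derive_cst.
  have hd := is_derive_mulmx_entry (is_derive_mulmx_entry hU hg) hUT b c.
  by rewrite [LHS](@derive_val _ _ _ _ _ _ _ hd) mulmx0 addr0.
(* Symmetry turns the entrywise double sum in [momentum] into the trace of a product. *)
have symX : X^T = X.
  by rewrite /X linearD /= !trmx_mul !trmxK metric_sym// !mulmxA addrC.
rewrite /momentum; transitivity (- 2^-1 * Num.sqrt (\det (h y v)) * \tr (invmx (h y v) *m X)).
  congr (_ * _); rewrite /mxtrace; apply: eq_bigr => b _; rewrite mxE.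
  by apply: eq_bigr => c _; rewrite -{1}symX mxE -dX.
rewrite mxtrace_variation ?invmx_induced_metric_sym// mxtrace_delta.
rewrite /impulse cometricE// -scalemxAr [in RHS]mxE.
by field.
Qed.

(** The integrand of the first variation at one fixed t: [eta] and [w] stand for the value and the
    gradient of the bump there, and [s] is the variation parameter. *)
Lemma is_derive_area_line y v k (eta : R) (w : 'rV[R]_m) (s : R) :
  let Y s := y + (s * eta) *: delta_mx 0 k in
  let U s := v + s *: (w^T *m delta_mx 0 k) in
  chart_dom M (Y s) -> 0 < \det (h (Y s) (U s)) ->
  is_derive s 1 (fun s => Num.sqrt (\det (h (Y s) (U s))))
    (eta * force k (Y s) (U s) + \sum_a w 0 a * impulse (Y s) (U s) k a).
Proof.
move=> Y U YM det_gt0.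
have hY i : is_derive s 1 (fun s => Y s 0 i) ((eta *: delta_mx 0 k : 'rV[R]_n) 0 i).
  have := is_derive_add (is_derive_cst (y 0 i) s 1) (is_derive_mul
    (is_derive_mul (is_derive_id s 1) (is_derive_cst eta s 1))
    (is_derive_cst ((delta_mx 0 k : 'rV[R]_n) 0 i) s 1)).
  rewrite !mulr0 !addr0 add0r mul1r.
  by congr is_derive; [apply/funext => s'; rewrite !mxE | rewrite !mxE].
have hg i j : is_derive s 1 (fun s => g (Y s) i j) ((eta *: dmetric k (Y s)) i j).
  have := is_derive_comp hY (metric_differentiable i j YM).
  congr is_derive; rewrite (bigD1 k)//= big1 => [|l lk].
    by rewrite addr0 !mxE !eqxx mulr1.
  by rewrite !mxE (negbTE lk) andbF mulr0 mul0r.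
have hU a i : is_derive s 1 (fun s => U s a i) ((w^T *m delta_mx 0 k : 'M[R]_(m, n)) a i).
  have := is_derive_add (is_derive_cst (v a i) s 1) (is_derive_mul
    (is_derive_id s 1) (is_derive_cst ((w^T *m delta_mx 0 k : 'M[R]_(m, n)) a i) s 1)).
  rewrite !mulr0 !addr0 add0r mul1r.
  by congr is_derive; apply/funext => s'; rewrite [in RHS]mxE [X in _ = _ + X]mxE.
have := is_derive_area hg hU YM det_gt0.
congr is_derive; congr (_ + _).
  have -> : U s *m (eta *: dmetric k (Y s)) *m (U s)^T =
      eta *: (U s *m dmetric k (Y s) *m (U s)^T) by rewrite -scalemxAr -scalemxAl.
  by rewrite -scalemxAr mxtraceZ mulrCA.
rewrite -mulmxA mxtrace_mulC -/(impulse _ _) -rowE /mxtrace big_ord1 mxE.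
by apply: eq_bigr => a _; rewrite !mxE mulrC.
Qed.

Section Continuity.
Context {T : Type} {F : set_system T} {FF : Filter F}.
Variables (Y : T -> 'rV[R]_n) (U : T -> 'M[R]_(m, n)) (y : 'rV[R]_n) (v : 'M[R]_(m, n)).
Hypotheses (cY : Y z @[z --> F] --> y).
Hypothesis cU : forall a i, U z a i @[z --> F] --> v a i.
Hypothesis yM : chart_dom M y.

(** This and the following limits are taken along an arbitrary filter, to serve both for continuity
    in t and for joint continuity in t and the variation parameter. *)
Lemma cvg_metric i j : g (Y z) i j @[z --> F] --> g y i j.
Proof.
apply: (cvg_comp _ (fun z => g z i j) cY).
exact: (@metric_smooth R n M i j 0).
Qed.

Lemma cvg_dmetric k i j : dmetric k (Y z) i j @[z --> F] --> dmetric k y i j.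
Proof.
rewrite mxE; under eq_cvg do rewrite mxE.
apply: (cvg_comp _ (pd k (fun z => g z i j)) cY).
by have [_ /(_ k)] := @metric_smooth R n M i j 1; exact.
Qed.

Let cUT i a : (U z)^T i a @[z --> F] --> v^T i a.
Proof. by rewrite mxE; under eq_cvg do rewrite mxE; exact: cU. Qed.

Lemma cvg_induced_metric a b : h (Y z) (U z) a b @[z --> F] --> h y v a b.
Proof.
apply: (cvg_mulmx_entry (A := fun z => U z *m g (Y z)) (B := fun z => (U z)^T) _ cUT).
exact: cvg_mulmx_entry cU cvg_metric.
Qed.

Lemma cvg_det_induced_metric :
  \det (h (Y z) (U z)) @[z --> F] --> \det (h y v).
Proof. by apply: cvg_det => a b; exact: cvg_induced_metric. Qed.

Lemma cvg_area :
  Num.sqrt (\det (h (Y z) (U z))) @[z --> F] --> Num.sqrt (\det (h y v)).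
Proof. exact: (cvg_comp _ Num.sqrt cvg_det_induced_metric (@sqrt_continuous R _)). Qed.

Hypothesis det_gt0 : 0 < \det (h y v).

Lemma cvg_cometric a b : cometric (Y z) (U z) a b @[z --> F] --> cometric y v a b.
Proof.
rewrite mxE; under eq_cvg do rewrite mxE.
apply: cvgM; last by apply: cvg_adj_entry => *; exact: cvg_induced_metric.
by apply: cvgV; [rewrite gt_eqF// sqrtr_gt0 | exact: cvg_area].
Qed.

Lemma cvg_force k : force k (Y z) (U z) @[z --> F] --> force k y v.
Proof.
apply: cvgM; first exact: cvg_cst.
apply: cvg_bigsum => a _; apply: cvg_mulmx_entry => [b c|]; first exact: cvg_cometric.
apply: (cvg_mulmx_entry (A := fun z => U z *m dmetric k (Y z)) (B := fun z => (U z)^T) _ cUT).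
apply: (cvg_mulmx_entry (A := U) (B := fun z => dmetric k (Y z)) cU) => i j.
exact: cvg_dmetric.
Qed.

Lemma cvg_impulse i a : impulse (Y z) (U z) i a @[z --> F] --> impulse y v i a.
Proof.
apply: cvg_mulmx_entry => [|b c]; last exact: cvg_cometric.
exact: cvg_mulmx_entry cvg_metric cUT.
Qed.

End Continuity.

End Area.

(** * Bump functions and regular sheets *)

Lemma open_forall (T : topologicalType) (I : finType) (W : I -> set T) :
  (forall i, open (W i)) -> open [set t | forall i, W i t].
Proof.
move=> oW; rewrite openE => t Wt; apply: filter_forall => i.
exact: open_nbhs_nbhs.
Qed.

Section Bump.
Context {R : realType} {m : nat}.

(* The bump max(0, r^2 - |t - c|^2)^3 is only of class C^2, which suffices here. *)
Definition pos_sqr (s : R) := Num.max 0 s ^+ 2.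

Lemma pos_sqr0 s : s <= 0 -> pos_sqr s = 0.
Proof. by move=> s0; rewrite /pos_sqr max_l// expr0n. Qed.

Lemma is_derive_pos_sqr (s : R) : is_derive s 1 pos_sqr (2 * Num.max 0 s).
Proof.
have [s0|s0|->] := ltgtP s 0.
- rewrite mulr0.
  apply: (near_eq_is_derive (f := fun=> 0)).
  near=> e; rewrite pos_sqr0// ltW//.
  by near: e; exact: lt_nbhsl.
- have h := is_derive_mul (is_derive_id s 1) (is_derive_id s 1).
  have -> : 2 * s = 1 * s + s * 1 by ring.
  apply: (near_eq_is_derive _ h).
  near=> e; rewrite /pos_sqr max_r ?expr2// ltW//.
  by near: e; exact: lt_nbhsr.
(* At the junction point the remainder is at most e^2, which is below d |e| as soon as |e| is at
   most d. *)
- rewrite mulr0; apply: is_derive_of_dist_le => d d0.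
  near=> e; rewrite mulr0 !subr0 (pos_sqr0 (lexx _)) subr0.
  have ed : `|e| <= d by near: e; exact: (@nbhs0_le _ R).
  have [e0|e0] := leP e 0; first by rewrite pos_sqr0// normr0 mulr_ge0// ltW.
  by rewrite /pos_sqr (max_r (ltW e0)) normrX expr2; exact: ler_wpM2r.
Unshelve. all: by end_near. Qed.

Definition pos_cube (s : R) := pos_sqr s * s.

Lemma is_derive_pos_cube (s : R) : is_derive s 1 pos_cube (3 * pos_sqr s).
Proof.
have := is_derive_mul (is_derive_pos_sqr s) (is_derive_id s 1).
congr is_derive; rewrite /pos_sqr /=.
by have [s0|s0] := leP 0 s; ring.
Qed.

Variables (c : 'rV[R]_m) (r : R).

(** Not a radius: for positive [r] it is positive exactly inside the Euclidean ball of radius [r]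
    about [c]. *)
Definition bump_radius (t : 'rV[R]_m) : R := r ^+ 2 - \sum_a (t 0 a - c 0 a) ^+ 2.

Definition bump t : R := pos_cube (bump_radius t).

Lemma bump_radius_pd t a : is_derive t (delta_mx 0 a) bump_radius (- (2 * (t 0 a - c 0 a))).
Proof.
have h b : is_derive t (delta_mx 0 a) (fun s : 'rV[R]_m => (s 0 b - c 0 b) ^+ 2)
    (2 * (t 0 b - c 0 b) * (b == a)%:R).
  have h1 := is_derive_add (is_derive_entry t (delta_mx 0 a) 0 b)
    (is_derive_cst (- c 0 b) t (delta_mx 0 a)).
  have := is_derive_mul h1 h1; rewrite mxE eqxx /= addr0.
  by congr is_derive; ring.
have := is_derive_add (is_derive_cst (r ^+ 2) t (delta_mx 0 a))
  (is_deriveN (is_derive_bigsum (index_enum 'I_m) (P := xpredT) (fun b _ => h b))).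
congr is_derive; rewrite add0r; congr (- _).
rewrite (bigD1 a)//= eqxx mulr1 big1 ?addr0// => b ba.
by rewrite (negbTE ba) mulr0.
Qed.

Lemma bump_radius_Ck k W : open W -> Ck k W bump_radius.
Proof.
move=> oW; have h : Ck k W (fun t => r ^+ 2 + \sum_a (-1) * ((t 0 a + - c 0 a) * (t 0 a + - c 0 a))).
  apply: CkD => //; first exact: Ck_cst.
  apply: Ck_bigsum => // a _; apply: CkM => //; first exact: Ck_cst.
  by apply: CkM => //; apply: CkD => //; [exact: Ck_coord | exact: Ck_cst | exact: Ck_coord | exact: Ck_cst].
apply: Ck_ext oW _ h => t _; rewrite -big_distrr /= mulN1r /bump_radius.
by congr (_ - _); apply: eq_bigr => a _; rewrite expr2.
Qed.

Lemma bump_pd a t : is_derive t (delta_mx 0 a) bump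
  (3 * pos_sqr (bump_radius t) * - (2 * (t 0 a - c 0 a))).
Proof. exact: is_derive_comp1 (bump_radius_pd t a) (is_derive_pos_cube _). Qed.

Lemma bump_pdE a : pd a bump =
  fun t => 3 * pos_sqr (bump_radius t) * - (2 * (t 0 a - c 0 a)).
Proof. by apply/funext => t; have h := bump_pd a t; exact: derive_val. Qed.

Lemma bump_C2 : Ck 2 setT bump.
Proof.
have cp : continuous (fun s : R => 3 * (2 * Num.max 0 s)).
  move=> s; apply: (@cvgM _ _ (nbhs s) _ (fun=> 3) (fun s => 2 * Num.max 0 s)); first exact: cvg_cst.
  apply: (@cvgM _ _ (nbhs s) _ (fun=> 2) (fun s => Num.max 0 s)); first exact: cvg_cst.
  by apply: (@continuous_max _ _ (fun=> 0) id); [exact: cst_continuous | exact: cvg_id].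
apply: (Ck_comp1 (dpsi := fun s => 3 * pos_sqr s) openT) => [t _||].
- exact: is_derive_pos_cube.
- apply: (Ck_comp1 (psi := fun s => 3 * pos_sqr s) (dpsi := fun s => 3 * (2 * Num.max 0 s)) openT) => [t _||].
  + have := is_derive_mul (is_derive_cst (3 : R) (bump_radius t) 1) (is_derive_pos_sqr (bump_radius t)).
    by rewrite mul0r add0r.
  + move=> t _; apply: continuous_comp; last exact: cp.
    exact: (@bump_radius_Ck 0 setT openT).
  + exact: (@bump_radius_Ck _ setT openT).
- exact: (@bump_radius_Ck _ setT openT).
Qed.

(** This is what complete integrability of the varied control amounts to. The explicit second
    derivative contains only (t_a - c_a)(t_b - c_b) and the Kronecker delta, both symmetric. *)
Lemma bump_pd_pd a b t : pd a (pd b bump) t = pd b (pd a bump) t.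
Proof.
have key a' b' : pd a' (pd b' bump) t =
    3 * (2 * Num.max 0 (bump_radius t) * - (2 * (t 0 a' - c 0 a'))) * - (2 * (t 0 b' - c 0 b'))
    + 3 * pos_sqr (bump_radius t) * - (2 * (a' == b')%:R).
  rewrite bump_pdE.
  have h1 := is_derive_comp1 (bump_radius_pd t a') (is_derive_pos_sqr (bump_radius t)).
  have h2 := is_derive_mul (is_derive_cst (3 : R) t (delta_mx 0 a')) h1.
  have h3 := is_derive_add (is_derive_entry t (delta_mx 0 a') 0 b')
    (is_derive_cst (- c 0 b') t (delta_mx 0 a')).
  have h4 := is_derive_mul (is_derive_cst (2 : R) t (delta_mx 0 a')) h3.
  have h := is_derive_mul h2 (is_deriveN h4).
  rewrite [LHS](@derive_val _ _ _ _ _ _ _ h) /= !mxE eqxx /= !mul0r !add0r addr0.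
  by rewrite [b' == a']eq_sym.
by rewrite !key eq_sym; ring.
Qed.

Lemma bump_ge0 t : 0 <= bump t.
Proof.
rewrite /bump /pos_cube; have [s0|s0] := leP (bump_radius t) 0.
  by rewrite pos_sqr0// mul0r.
by rewrite mulr_ge0 ?(ltW s0)// sqr_ge0.
Qed.

Lemma bump_out t : bump_radius t <= 0 -> bump t = 0 /\ forall a, pd a bump t = 0.
Proof.
move=> h; split=> [|a]; first by rewrite /bump /pos_cube pos_sqr0// mul0r.
by rewrite bump_pdE pos_sqr0// mulr0 mul0r.
Qed.

Hypothesis r0 : 0 < r.

Lemma bump_center_gt0 : 0 < bump c.
Proof.
have -> : bump c = (r ^+ 2) ^+ 3.
  rewrite /bump /pos_cube /pos_sqr /bump_radius big1 => [|a _]; last by rewrite subrr expr0n.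
  by rewrite subr0 max_r ?sqr_ge0// [RHS]exprSr.
by rewrite !exprn_gt0.
Qed.

(** [ball] refers to the maximum norm and is open; the factor 2 gives room for the closed Euclidean
    ball of radius [r]. *)
Lemma bump_radius_ball t : 0 <= bump_radius t -> ball c (2 * r) t.
Proof.
move=> h; rewrite -ball_normE /=; have r20 : 0 < 2 * r by rewrite mulr_gt0.
rewrite -normrN opprB.
have : ball_ (fun x => `|x|) c (2 * r) t; last by rewrite /ball_ /= -normrN opprB.
rewrite -mx_norm_ball; split=> // i j; rewrite ord1 -ball_normE /=.
have : (t 0 j - c 0 j) ^+ 2 <= r ^+ 2.
  move: h; rewrite subr_ge0; apply: le_trans.
  rewrite (bigD1 j)//= lerDl; apply: sumr_ge0 => a _; exact: sqr_ge0.
rewrite -[(_ - _) ^+ 2]real_normK ?num_real// ler_sqr ?nnegrE ?(ltW r0)// distrC.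
by move=> /le_lt_trans; apply; rewrite ltr_pMl// ltr1n.
Qed.

End Bump.

(** * Sheets that are regular on a neighbourhood of the box *)

Section RegularSheet.
Context {R : realType} {m n : nat} (M : riemannian_chart R n).

(** Working on an open set around the box makes derivatives at its boundary points ordinary
    two-sided ones and allows identities valid on [W] to be differentiated. *)
Record regular_on (W : set 'rV[R]_m) (x : 'rV[R]_m -> 'rV[R]_n) : Prop := RegularOn {
  regular_open : open W;
  regular_C2 : forall i, Ck 2 W (fun t => x t 0 i);
  regular_dom : forall t, W t -> chart_dom M (x t);
  regular_det : forall t, W t -> 0 < \det (induced_metric M (x t) (velocity x t))
}.

Section Regular.
Context {W : set 'rV[R]_m} {x : 'rV[R]_m -> 'rV[R]_n}.
Hypothesis regx : regular_on W x.
Let oW := regular_open regx.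

Lemma velocity_C1 a i : Ck 1 W (fun t => velocity x t a i).
Proof.
under eq_fun do rewrite mxE.
by have [_ /(_ a)] := regular_C2 regx i.
Qed.

Lemma metric_C1 i j : Ck 1 W (fun t => metric M (x t) i j).
Proof.
apply: (@C1_comp _ _ _ W (chart_dom M) (fun z => metric M z i j)) => //.
- exact: regular_dom.
- by move=> l; apply: CkW; exact: regular_C2.
- exact: (@metric_smooth R n M i j 1).
Qed.

Lemma induced_metric_C1 a b :
  Ck 1 W (fun t => induced_metric M (x t) (velocity x t) a b).
Proof.
apply: Ck_mulmx => //; last first.
  by move=> i c; under eq_fun do rewrite mxE; exact: velocity_C1.
by apply: Ck_mulmx => //; [exact: velocity_C1 | exact: metric_C1].
Qed.

(** The positive determinant keeps the square root and the inversion away from 0, where they fail to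
    be C^1. *)
Lemma cometric_C1 a b : Ck 1 W (fun t => cometric (M := M) (x t) (velocity x t) a b).
Proof.
under eq_fun do rewrite mxE.
apply: CkM => //; last by apply: Ck_adj => // *; exact: induced_metric_C1.
have cD : Ck 1 W (fun t => \det (induced_metric M (x t) (velocity x t))).
  by apply: Ck_det => // *; exact: induced_metric_C1.
have cD0 := CkW cD.
have cs t : W t -> {for t, continuous (fun t => Num.sqrt (\det (induced_metric M (x t) (velocity x t))))}.
  by move=> Wt; apply: continuous_comp; [exact: cD0 | exact: sqrt_continuous].
have s0 t : W t -> Num.sqrt (\det (induced_metric M (x t) (velocity x t))) != 0.
  by move=> Wt; rewrite gt_eqF// sqrtr_gt0; exact: regular_det regx _ Wt.
have cs1 : Ck 1 W (fun t => Num.sqrt (\det (induced_metric M (x t) (velocity x t)))).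
  apply: (Ck_comp1 (psi := Num.sqrt) (dpsi := fun s => (2 * Num.sqrt s)^-1) oW) cD => t Wt.
    by apply: is_derive1_sqrt; exact: regular_det regx _ Wt.
  apply: (@cvgV _ _ (nbhs t) _ (fun t => 2 * Num.sqrt (\det (induced_metric M (x t) (velocity x t))))).
    by rewrite mulf_neq0// ?pnatr_eq0// s0.
  exact: (@cvgM _ _ (nbhs t) _ (fun=> 2) _ _ _ (cvg_cst _) (cs t Wt)).
apply: (Ck_comp1 (psi := GRing.inv) (dpsi := fun s => - s ^- 2) oW) cs1 => t Wt.
  have hs := s0 t Wt; apply: DeriveDef; first by apply: derivableV.
  by rewrite deriveV// derive_id [_ *: _]mulr1.
apply: (@cvgN _ _ _ (nbhs t) _ (fun t => Num.sqrt (\det (induced_metric M (x t) (velocity x t))) ^- 2)).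
apply: (@cvgV _ _ (nbhs t) _ (fun t => Num.sqrt (\det (induced_metric M (x t) (velocity x t))) ^+ 2)).
  by rewrite expf_neq0// s0.
exact: (@cvgM _ _ (nbhs t) _ _ _ _ _ (cs t Wt) (cs t Wt)).
Qed.

Lemma impulse_C1 i a : Ck 1 W (fun t => impulse (M := M) (x t) (velocity x t) i a).
Proof.
apply: Ck_mulmx => //; last exact: cometric_C1.
apply: Ck_mulmx => //; first exact: metric_C1.
by move=> j b; under eq_fun do rewrite mxE; exact: velocity_C1.
Qed.

Lemma sheet_continuous t : W t -> {for t, continuous x}.
Proof.
move=> Wt; apply: (@cvg_matrix _ _ (nbhs t)) => i j; rewrite ord1.
exact: (CkW (CkW (regular_C2 regx j))).
Qed.

Lemma force_C0 k : Ck 0 W (fun t => force (M := M) k (x t) (velocity x t)).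
Proof.
move=> t Wt; apply: (cvg_force (F := nbhs t)).
- exact: sheet_continuous.
- by move=> a i; exact: (CkW (velocity_C1 a i)).
- exact: regular_dom regx _ Wt.
- exact: regular_det regx _ Wt.
Qed.

(** Formed from the area density rather than the Lagrangian, hence of opposite sign to the left-hand
    side of the Euler-Lagrange equation. *)
Definition euler_form k t : R := force (M := M) k (x t) (velocity x t) -
  \sum_a pd a (fun s => impulse (M := M) (x s) (velocity x s) k a) t.

Lemma euler_form_C0 k : Ck 0 W (euler_form k).
Proof.
have hP a : Ck 0 W (pd a (fun t => impulse (M := M) (x t) (velocity x t) k a)).
  exact: (impulse_C1 k a).2.
have hS : Ck 0 W (fun t => \sum_a pd a (fun s => impulse (M := M) (x s) (velocity x s) k a) t).
  by apply: Ck_bigsum.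
have := CkD oW (@force_C0 k) (CkM oW (Ck_cst 0 W (-1)) hS).
by apply: Ck_ext => // t _; rewrite mulN1r.
Qed.

Lemma euler_formE k t : W t ->
  dL_dx M k (x t) (velocity x t) -
  \sum_a pd a (fun s => momentum M k a (x s) (velocity x s)) t = - euler_form k t.
Proof.
move=> Wt; rewrite dL_dxE; [|exact: regular_dom regx _ Wt|exact: regular_det regx _ Wt].
rewrite opprB [RHS]addrC; congr (_ + _); rewrite -sumrN; apply: eq_bigr => a _.
(* [momentum] is identified with minus [impulse] only on [W]; agreement near t suffices for the
   derivatives. *)
rewrite /pd (near_eq_derive (g := fun s => - impulse (M := M) (x s) (velocity x s) k a)).
  rewrite deriveN ?opprK//; apply: diff_derivable; exact: (impulse_C1 k a).1.
have nW : \forall s \near t, W s by exact: open_nbhs_nbhs.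
apply: filterS nW => s Ws; apply: momentumE; first exact: regular_dom regx _ Ws.
exact: regular_det regx _ Ws.
Qed.

End Regular.

End RegularSheet.

(** * The first variation *)

Section VariationDef.
Context {R : realType} {m n : nat}.
Variables (x : 'rV[R]_m -> 'rV[R]_n) (u : 'rV[R]_m -> 'M[R]_(m, n)).
Variables (eta : 'rV[R]_m -> R) (k : 'I_n).

Definition vary_sheet (e : R) t : 'rV[R]_n := x t + (e * eta t) *: delta_mx 0 k.

(** The outer product places the gradient of [eta] in column [k]: it is the velocity of the
    displacement eta e_k. *)
Definition vary_control (e : R) t : 'M[R]_(m, n) :=
  u t + e *: ((\row_a pd a eta t)^T *m delta_mx 0 k).

Lemma vary_sheetE e t i : vary_sheet e t 0 i = x t 0 i + e * (eta t * (i == k)%:R).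
Proof. by rewrite !mxE mulrA. Qed.

Lemma vary_controlE e t a i :
  vary_control e t a i = u t a i + e * (pd a eta t * (i == k)%:R).
Proof. by rewrite [LHS]mxE [X in _ + X]mxE mxE big_ord1 !mxE. Qed.

Lemma vary_sheet0 t : vary_sheet 0 t = x t.
Proof. by rewrite /vary_sheet mul0r scale0r addr0. Qed.

Lemma vary_control0 t : vary_control 0 t = u t.
Proof. by rewrite /vary_control scale0r addr0. Qed.

Section AlongFilter.
Context {T : Type} {F : set_system T} {FF : Filter F}.
Variables (e : T -> R) (s : T -> 'rV[R]_m) (e0 : R) (t : 'rV[R]_m).
Hypotheses (ce : e z @[z --> F] --> e0) (cs : s z @[z --> F] --> t).

Lemma cvg_vary_sheet : {for t, continuous x} -> {for t, continuous eta} ->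
  vary_sheet (e z) (s z) @[z --> F] --> vary_sheet e0 t.
Proof.
move=> cx ceta; have cxs : x (s z) @[z --> F] --> x t by exact: (cvg_comp _ x cs cx).
have cetas : eta (s z) @[z --> F] --> eta t by exact: (cvg_comp _ eta cs ceta).
apply: (@cvgD _ _ _ F _ (fun z => x (s z))) cxs _.
by apply: (@cvgZr_tmp _ _ _ F) => //; exact: cvgM.
Qed.

Lemma cvg_vary_control a i : {for t, continuous (fun s => u s a i)} ->
  {for t, continuous (pd a eta)} ->
  vary_control (e z) (s z) a i @[z --> F] --> vary_control e0 t a i.
Proof.
move=> cu cd.
have cus : u (s z) a i @[z --> F] --> u t a i by exact: (cvg_comp _ (fun s => u s a i) cs cu).
have cds : pd a eta (s z) @[z --> F] --> pd a eta t by exact: (cvg_comp _ (pd a eta) cs cd).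
have -> : (fun z => vary_control (e z) (s z) a i) =
    (fun z => u (s z) a i + e z * (pd a eta (s z) * (i == k)%:R)).
  by apply/funext => z; rewrite vary_controlE.
rewrite vary_controlE.
apply: cvgD => //; apply: cvgM => //; apply: cvgM => //; exact: cvg_cst.
Qed.

End AlongFilter.

End VariationDef.

Lemma open_box_open (R : realType) m (tau : 'rV[R]_m) :
  open [set t : 'rV[R]_m | forall a, 0 < t 0 a < tau 0 a].
Proof.
apply: open_forall => a.
have oI : open [set r : R | 0 < r < tau 0 a].
  rewrite (_ : mkset _ = `]0, tau 0 a[%classic); first exact: interval_open.
  by apply/seteqP; split=> r; rewrite /= in_itv.
apply: (@open_comp _ _ (fun s : 'rV[R]_m => s 0 a) _ _ oI).
by move=> s _; exact: coord_continuous.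
Qed.

Lemma open_box_interior (R : realType) m (tau t : 'rV[R]_m) :
  (forall a, 0 < t 0 a < tau 0 a) -> (box tau)° t.
Proof.
move=> ht; apply: filterS (open_nbhs_nbhs (conj (@open_box_open _ _ tau) ht)) => s hs a.
by have /andP[/ltW -> /ltW ->] := hs a.
Qed.

Section FirstVariation.
Context {R : realType} {m n : nat} {M : riemannian_chart R n}.
Context {tau : 'rV[R]_m} {x0 x1 : 'rV[R]_n} {ub : option ('rV[R]_m -> 'M[R]_(m, n))}.
Context {x : 'rV[R]_m -> 'rV[R]_n} {u : 'rV[R]_m -> 'M[R]_(m, n)} {W : set 'rV[R]_m}.
Hypotheses (m_gt0 : (0 < m)%N) (tau_gt0 : forall a, 0 < tau 0 a).
Hypotheses (regx : regular_on M W x) (boxW : box tau `<=` W).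
Hypothesis feas : feasible M tau x0 x1 ub x u.

Lemma velocity_control t : box tau t -> velocity x t = u t.
Proof.
move=> bt; apply/matrixP => a i; rewrite mxE /pd.
by have h := feasible_state feas bt a i; exact: derive_val.
Qed.

Context {eta : 'rV[R]_m -> R}.
Variable k : 'I_n.
Hypothesis eta_C2 : Ck 2 setT eta.
Hypothesis eta_sym : forall a b t, pd a (pd b eta) t = pd b (pd a eta) t.
Hypothesis eta_out : forall t : 'rV[R]_m, ~ (forall a, 0 < t 0 a < tau 0 a) ->
  eta t = 0 /\ forall a, pd a eta t = 0.

Local Notation X := (vary_sheet x eta k).
Local Notation U := (vary_control u eta k).

(** The two constraints that a variation might violate inside the box, phrased as open
    conditions. *)
Let good e t := chart_dom M (X e t) /\ 0 < \det (induced_metric M (X e t) (U e t)).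

Let deta_C1 a : Ck 1 setT (pd a eta).
Proof. by have [_ h] := eta_C2; exact: h. Qed.

Section AlongFilter.
Context {T : Type} {F : set_system T} {FF : Filter F}.
Context {e : T -> R} {s : T -> 'rV[R]_m} {e0 : R} {t : 'rV[R]_m}.
Hypotheses (bt : box tau t) (ce : e z @[z --> F] --> e0) (cs : s z @[z --> F] --> t).

Let X_cvg : X (e z) (s z) @[z --> F] --> X e0 t.
Proof.
apply: cvg_vary_sheet => //; first by apply: sheet_continuous regx _ _; exact: boxW.
exact: (CkW (CkW eta_C2)).
Qed.

Let U_cvg a i : U (e z) (s z) a i @[z --> F] --> U e0 t a i.
Proof.
apply: cvg_vary_control => //; last exact: (CkW (deta_C1 a)).
by have [V [_ VB /CkW cu]] := control_C1 (feasible_control feas) a i; exact/cu/VB.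
Qed.

Hypothesis XM : chart_dom M (X e0 t).

Lemma vary_chart : \forall z \near F, chart_dom M (X (e z) (s z)).
Proof.
have nXM : nbhs (X e0 t) (chart_dom M).
  by apply: open_nbhs_nbhs; split; [exact: chart_dom_open | exact: XM].
exact: (X_cvg nXM).
Qed.

Lemma vary_area_cvg :
  Num.sqrt (\det (induced_metric M (X (e z) (s z)) (U (e z) (s z)))) @[z --> F] -->
  Num.sqrt (\det (induced_metric M (X e0 t) (U e0 t))).
Proof. exact: (cvg_area (F := F) X_cvg U_cvg XM). Qed.

Hypothesis det_gt0 : 0 < \det (induced_metric M (X e0 t) (U e0 t)).

Lemma vary_det : \forall z \near F, 0 < \det (induced_metric M (X (e z) (s z)) (U (e z) (s z))).
Proof. exact: (cvgr_gt _ (cvg_det_induced_metric (F := F) X_cvg U_cvg XM) _ det_gt0). Qed.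

Lemma vary_area_derivative_cvg :
  eta (s z) * force (M := M) k (X (e z) (s z)) (U (e z) (s z)) +
    \sum_a pd a eta (s z) * impulse (M := M) (X (e z) (s z)) (U (e z) (s z)) k a @[z --> F] -->
  eta t * force (M := M) k (X e0 t) (U e0 t) +
    \sum_a pd a eta t * impulse (M := M) (X e0 t) (U e0 t) k a.
Proof.
have c1 : eta (s z) @[z --> F] --> eta t.
  by apply: (cvg_comp _ eta cs); exact: (CkW (CkW eta_C2)).
have /(_ _) c2 := cvg_force (F := F) X_cvg U_cvg XM det_gt0 (k := k).
have c3 a : pd a eta (s z) @[z --> F] --> pd a eta t.
  by apply: (cvg_comp _ (pd a eta) cs); exact: (CkW (deta_C1 a)).
have /(_ _) c4 := cvg_impulse (F := F) X_cvg U_cvg XM det_gt0 (i := k).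
apply: cvgD; first exact: cvgM c1 c2.
by apply: cvg_bigsum => a _; exact: cvgM (c3 a) (c4 a).
Qed.

End AlongFilter.

Let good0 t : box tau t -> good 0 t.
Proof.
move=> bt; rewrite /good vary_sheet0 vary_control0 -velocity_control//; have Wt := boxW bt.
by split; [exact: regular_dom regx _ Wt | exact: regular_det regx _ Wt].
Qed.

Let near_good_at t : box tau t -> \forall t' \near t & e \near (0 : R), good e t'.
Proof.
move=> bt; have [XM det_gt0] := good0 bt.
have /(_ _ _ _) h1 := @vary_chart _ (nbhs (t, 0 : R)) _ snd fst 0 t bt cvg_snd cvg_fst XM.
have /(_ _ _ _) h2 := @vary_det _ (nbhs (t, 0 : R)) _ snd fst 0 t bt cvg_snd cvg_fst XM det_gt0.
have := filterI h1 h2; exact.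
Qed.

(** The conditions hold on a product neighbourhood of each (t, 0), and compactness of the box
    extracts a common range of e. *)
Let near_good : \forall e \near (0 : R), box tau `<=` good e.
Proof.
exact: ((compact_near_coveringP (box tau)).1 (@box_compact _ _ tau) R (nbhs (0 : R)) good _ near_good_at).
Qed.

(** Rank comes from the positive determinant, integrability from the commuting second derivatives of
    [eta], and the endpoint and boundary conditions from the vanishing of [eta] and its gradient off
    the open box. *)
Lemma feasible_variation e : box tau `<=` good e -> feasible M tau x0 x1 ub (X e) (U e).
Proof.
move=> ge; have [ctl bnd dom state start end_] := feas.
(* Both [0] and [tau] qualify once there is at least one coordinate, which is where [m_gt0]
   enters. *)
have corner (t : 'rV[R]_m) : (exists a, t 0 a <= 0 \/ tau 0 a <= t 0 a) -> X e t = x t.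
  move=> [a ha]; rewrite /vary_sheet.
  have [|-> _] := @eta_out t; last by rewrite mulr0 scale0r addr0.
  by move=> /(_ a) /andP[h1 h2]; case: ha; rewrite leNgt ?h1 ?h2.
split.
- split.
  + move=> a i; have [V [oV VB cV]] := control_C1 ctl a i; exists V; split=> //.
    have cd : Ck 1 V (pd a eta) by exact: Ck_sub (deta_C1 a).
    have h1 := CkM oV cd (Ck_cst 1 V ((i == k)%:R : R)).
    have h2 := CkM oV (Ck_cst 1 V e) h1.
    by apply: Ck_ext (CkD oV cV h2) => // t _; rewrite vary_controlE.
  + move=> t /ge[_ h]; apply: (row_free_det_induced_metric (M := M) (y := X e t)).
    by rewrite gt_eqF.
  + move=> t bt a b i.
    have key a' b' : pd b' (fun s => U e s a' i) t =
        pd b' (fun s => u s a' i) t + e * (pd b' (pd a' eta) t * (i == k)%:R).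
      have [V [_ VB [dV _]]] := control_C1 ctl a' i.
      have h1 := is_derive_pd b' (dV t (VB t bt)).
      have h2 := is_derive_pd b' ((deta_C1 a').1 t I).
      have h := is_derive_add h1 (is_derive_mul (is_derive_cst e t (delta_mx 0 b'))
        (is_derive_mul h2 (is_derive_cst ((i == k)%:R : R) t (delta_mx 0 b')))).
      rewrite mul0r add0r mulr0 addr0 in h.
      rewrite (_ : (fun s => U e s a' i) = fun s => u s a' i + e * (pd a' eta s * (i == k)%:R)).
        exact: (@derive_val _ _ _ _ _ _ _ h).
      by apply/funext => s; rewrite vary_controlE.
    by rewrite (key a b) (key b a) (control_integrable ctl bt a b i) eta_sym.
- case: ub bnd => // w bnd t bt; rewrite -bnd//.
  have nt : ~ (forall a, 0 < t 0 a < tau 0 a).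
    by move=> /open_box_interior ht; have [_ nb] := bt; exact: nb.
  apply/matrixP => a i; rewrite vary_controlE; have [_ ->] := eta_out nt.
  by rewrite mul0r mulr0 addr0.
- by move=> t /ge[].
- move=> t bt a i.
  have hd : is_derive t (delta_mx 0 a) eta (pd a eta t).
    by apply: is_derive_pd; have [h _] := eta_C2; exact: h.
  have h := is_derive_add (state t bt a i) (is_derive_mul
    (is_derive_cst e t (delta_mx 0 a)) (is_derive_mul hd (is_derive_cst ((i == k)%:R : R) t (delta_mx 0 a)))).
  rewrite mul0r add0r mulr0 addr0 in h.
  rewrite (_ : (fun s => X e s 0 i) = fun s => x s 0 i + e * (eta s * (i == k)%:R)).
    by rewrite vary_controlE.
  by apply/funext => s; rewrite vary_sheetE.
- by rewrite corner//; exists (Ordinal m_gt0); left; rewrite mxE.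
- by rewrite corner//; exists (Ordinal m_gt0); right.
Qed.

Let is_derive_area_integral :
  is_derive (0 : R) 1
    (fun e => box_integral tau (fun t => Num.sqrt (\det (induced_metric M (X e t) (U e t)))))
    (box_integral tau (fun t => eta t * force (M := M) k (X 0 t) (U 0 t) +
      \sum_a pd a eta t * impulse (M := M) (X 0 t) (U 0 t) k a)).
Proof.
apply: (@is_derive_box_integral _ _ tau _
  (fun e t => Num.sqrt (\det (induced_metric M (X e t) (U e t))))
  (fun e t => eta t * force (M := M) k (X e t) (U e t) +
      \sum_a pd a eta t * impulse (M := M) (X e t) (U e t) k a) 0) => [a|t bt|t bt|].
- exact: ltW.
- apply: filterS (near_good_at bt) => -[t' e] /= [XM det_gt0].
  have := is_derive_area_line XM det_gt0.
  by congr is_derive; congr (_ + _); apply: eq_bigr => a _; rewrite mxE.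
- have [XM det_gt0] := good0 bt.
  exact: (@vary_area_derivative_cvg _ (nbhs (t, 0 : R)) _ snd fst 0 t bt cvg_snd cvg_fst XM det_gt0).
- apply: filterS near_good => e ge t bt; have [XM _] := ge t bt.
  exact: (@vary_area_cvg _ (nbhs t) _ (fun=> e) id e t bt (cvg_cst e) cvg_id XM).
Qed.

Hypothesis opt : forall x' u', feasible M tau x0 x1 ub x' u' ->
  cost M tau x' u' <= cost M tau x u.

(** The cost is minus the area, so an optimal sheet minimises area among the variations and Fermat's
    criterion applies at e = 0. *)
Lemma first_variation :
  box_integral tau (fun t => eta t * force (M := M) k (x t) (velocity x t) +
    \sum_a pd a eta t * impulse (M := M) (x t) (velocity x t) k a) = 0.
Proof.
have h0 : box_integral tau (fun t => eta t * force (M := M) k (X 0 t) (U 0 t) +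
      \sum_a pd a eta t * impulse (M := M) (X 0 t) (U 0 t) k a) = 0.
  apply: (is_derive_min0 is_derive_area_integral).
  apply: filterS near_good => e ge.
  have := opt (feasible_variation ge); rewrite /cost lerN2.
  congr (_ <= _); apply: eq_box_integral => t _.
  by rewrite vary_sheet0 vary_control0.
rewrite -[RHS]h0; apply: eq_box_integral => t bt.
by rewrite vary_sheet0 vary_control0 velocity_control.
Qed.

End FirstVariation.

(** * The Euler-Lagrange equation *)

Lemma box_integral_bigsum (R : realType) q (s : 'rV[R]_q) (I : Type) (l : seq I)
    (f : I -> 'rV[R]_q -> R) :
  (forall a, 0 <= s 0 a) -> (forall i, continuous (f i)) ->
  box_integral s (fun t => \sum_(i <- l) f i t) = \sum_(i <- l) box_integral s (f i).
Proof.
move=> s0 cf; elim: l => [|i l IH].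
  rewrite big_nil -[RHS](box_integral0 s).
  by apply: eq_box_integral => t _; rewrite big_nil.
rewrite big_cons -IH -[X in X + _]mul1r -(box_integral_linear s0).
- by apply: eq_box_integral => t _; rewrite big_cons mul1r.
- by move=> t _; exact: cf.
- by move=> t _; apply: (cvg_bigsum (F := nbhs t)) => j _; exact: cf.
Qed.

Section BumpExtension.
Context {R : realType} {m : nat} {c : 'rV[R]_m} {r : R} {W : set 'rV[R]_m}.
Hypotheses (r_gt0 : 0 < r) (oW : open W) (ballW : ball c (2 * r) `<=` W).

Lemma bump_outside (t : 'rV[R]_m) : ~ ball c (2 * r) t ->
  bump c r t = 0 /\ forall a, pd a (bump c r) t = 0.
Proof.
move=> nt; apply: bump_out; rewrite leNgt; apply/negP => /ltW h.
by apply: nt; exact: bump_radius_ball.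
Qed.

(** Regularity of [f] is known on [W] alone. The product is regular there and is zero on the open
    set [V] outside the closed support of the bump; the two sets cover the space because that
    support lies in [W]. *)
Lemma bump_mul_Ck j (f : 'rV[R]_m -> R) : (j <= 2)%N -> Ck j W f ->
  Ck j setT (fun t => bump c r t * f t).
Proof.
move=> j2 cf.
have cb : Ck j setT (bump c r).
  have c2 := bump_C2 c r.
  by case: j j2 {cf} => [|[|[|//]]] _; [exact: CkW (CkW c2)|exact: CkW c2|exact: c2].
pose V := [set t | bump_radius c r t < 0].
have oV : open V.
  apply: (@open_comp _ _ (bump_radius c r) [set s | s < 0]); last exact: open_lt.
  by move=> t _; exact: (@bump_radius_Ck _ _ c r 0 setT openT).
have WV : W `|` V = setT.
  apply/seteqP; split=> // t _; have [h|h] := ltP (bump_radius c r t) 0; first by right.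
  by left; apply: ballW; exact: bump_radius_ball.
rewrite -WV; apply: Ck_setU.
  by apply: CkM => //; exact: Ck_sub cb.
apply: (@Ck_ext _ _ j V (fun=> 0)) => //; last exact: Ck_cst.
by move=> t /ltW /bump_out[-> _]; rewrite mul0r.
Qed.

End BumpExtension.

Section EulerLagrange.
Context {R : realType} {m n : nat} {M : riemannian_chart R n}.
Context {tau : 'rV[R]_m} {x0 x1 : 'rV[R]_n} {ub : option ('rV[R]_m -> 'M[R]_(m, n))}.
Context {x : 'rV[R]_m -> 'rV[R]_n} {u : 'rV[R]_m -> 'M[R]_(m, n)} {W : set 'rV[R]_m}.
Hypotheses (m_gt0 : (0 < m)%N) (tau_gt0 : forall a, 0 < tau 0 a).
Hypotheses (regx : regular_on M W x) (boxW : box tau `<=` W).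
Hypothesis optx : optimal M tau x0 x1 ub x u.

Local Notation E := (euler_form M (x := x)).

Let oW := regular_open regx.

(** By the product rule the first-variation integrand equals the bump times [E k] plus the
    divergence of the bump times [impulse], and the divergence integrates to 0. *)
Lemma box_integral_bump_euler_form c r k : 0 < r -> ball c (2 * r) `<=` W ->
  (forall t, ball c (2 * r) t -> forall a, 0 < t 0 a < tau 0 a) ->
  box_integral tau (fun t => bump c r t * E k t) = 0.
Proof.
move=> r_gt0 ballW ballB; have [feas opt] := optx.
have out (t : 'rV[R]_m) : ~ (forall a, 0 < t 0 a < tau 0 a) ->
    bump c r t = 0 /\ forall a, pd a (bump c r) t = 0.
  by move=> nt; apply: bump_outside => // /ballB.
have fv := first_variation m_gt0 tau_gt0 regx boxW feas k (bump_C2 c r) (bump_pd_pd c r) out opt.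
pose h a t := bump c r t * impulse (M := M) (x t) (velocity x t) k a.
have hC1 a : Ck 1 setT (h a).
  by apply: (bump_mul_Ck r_gt0 oW ballW) => //; exact: impulse_C1.
have cpd a : continuous (pd a (h a)) by move=> t; have [_ hh] := hC1 a; exact: hh.
have tau0 a := ltW (tau_gt0 a).
have Ih a : box_integral tau (pd a (h a)) = 0.
  by apply: box_integral_pd => // t nt; rewrite /h; have [-> _] := out t nt; rewrite mul0r.
have cE : Ck 0 setT (fun t => bump c r t * E k t).
  by apply: (bump_mul_Ck r_gt0 oW ballW) => //; exact: euler_form_C0.
rewrite -[RHS]fv.
rewrite [RHS](@eq_box_integral _ _ _ _ (fun t => 1 * (bump c r t * E k t) + \sum_a pd a (h a) t)).
  rewrite box_integral_linear//; last 2 first.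
  - by move=> t _; exact: cE.
  - by move=> t _; apply: (cvg_bigsum (F := nbhs t)) => a _; exact: cpd.
  rewrite box_integral_bigsum// big1 => [|a _]; last exact: Ih.
  by rewrite addr0 mul1r.
move=> t bt; rewrite mul1r /euler_form mulrBr -addrA.
congr (_ + _); rewrite big_distrr /= addrC -sumrB; apply: eq_bigr => a _.
rewrite /h (@pdM _ _ (bump c r)).
- by rewrite addrK.
- by have [hh _] := bump_C2 c r; exact: hh.
- exact: (impulse_C1 regx k a).1 _ (boxW bt).
Qed.

Lemma open_box_dense (t : 'rV[R]_m) (A : set 'rV[R]_m) : box tau t -> open A -> A t ->
  exists2 c, A c & forall a, 0 < c 0 a < tau 0 a.
Proof.
move=> bt oA At.
(* The segment from [t] to the centre of the box: every step [s] with 0 < s <= 1/2 lands strictly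
   inside. *)
pose f (s : R) : 'rV[R]_m := t + s *: (2^-1 *: tau - t).
have cf : f s @[s --> (0 : R)] --> f 0.
  apply: (@cvgD _ _ _ (nbhs (0 : R)) _ (fun=> t) (fun s : R => s *: (2^-1 *: tau - t))); first exact: cvg_cst.
  by apply: (@cvgZr_tmp _ _ _ (nbhs (0 : R))); exact: cvg_id.
have f0 : f 0 = t by rewrite /f scale0r addr0.
rewrite f0 in cf.
have /(cf _) /(nbhs_ballP _ _).1 [r /= r0 hr] := open_nbhs_nbhs (conj oA At).
pose s := Num.min (r / 2) 2^-1.
have s0 : 0 < s by rewrite lt_min divr_gt0//= invr_gt0.
have sr : s < r.
  by apply: (@le_lt_trans _ _ (r / 2)); [rewrite ge_min lexx | rewrite ltr_pdivrMr// ltr_pMr// ltr1n].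
have s1 : s <= 2^-1 by rewrite ge_min lexx orbT.
exists (f s); first by apply: hr; rewrite -ball_normE /= sub0r normrN gtr0_norm.
move=> a; rewrite !mxE; have := bt a; have := tau_gt0 a.
move: (t 0 a) (tau 0 a) => p q q0 /andP[p0 pq].
by apply/andP; split; nra.
Qed.

Lemma euler_form_eq0 k t : box tau t -> E k t = 0.
Proof.
(* Multiplying by [b], the value of [E k] at t, makes the product positive at t whatever the sign of
   that value. *)
move=> bt; apply/eqP; apply/negP => /negP E0; pose b := E k t.
have tau0 a := ltW (tau_gt0 a).
have cE s : W s -> {for s, continuous (E k)} by exact: euler_form_C0.
pose A := [set s | W s /\ 0 < b * E k s].
have oA : open A.
  rewrite openE => s [Ws hs]; apply: filterI; first exact: open_nbhs_nbhs.
  have cb : b * E k z @[z --> s] --> b * E k s.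
    exact: (@cvgM _ _ (nbhs s) _ (fun=> b) _ _ _ (cvg_cst _) (cE s Ws)).
  exact: (cvgr_gt _ cb _ hs).
have At : A t.
  by split; [exact: boxW | rewrite -expr2 exprn_even_gt0].
have [c Ac bc] := open_box_dense bt oA At.
have /(_ _) nAB := filterI (open_nbhs_nbhs (conj oA Ac)) (open_nbhs_nbhs (conj (@open_box_open _ _ tau) bc)).
have [r2 /= r20 hr] := (nbhs_ballP _ _).1 nAB.
(* Halved because a bump of parameter [r] is supported in [ball c (2 * r)]. *)
pose r := r2 / 2; have r0 : 0 < r by rewrite divr_gt0.
have r2E : r2 = 2 * r by rewrite mulrC divfK.
rewrite r2E in hr.
have ballW : ball c (2 * r) `<=` W by move=> s /hr[[]].
have IE : box_integral tau (fun t => bump c r t * E k t) = 0.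
  by apply: box_integral_bump_euler_form => // s /hr[].
have cEk : Ck 0 W (E k) by exact: euler_form_C0.
have cbE : Ck 0 W (fun t => b * E k t) := CkM oW (Ck_cst 0 W b) cEk.
have cF : Ck 0 setT (fun t => bump c r t * (b * E k t)).
  exact: (bump_mul_Ck r0 oW ballW (leq0n 2) cbE).
have cF0 : Ck 0 setT (fun t => bump c r t * E k t).
  exact: (bump_mul_Ck r0 oW ballW (leq0n 2) cEk).
have F0 s : box tau s -> 0 <= bump c r s * (b * E k s).
  move=> _; have [bs|nbs] := pselect (ball c (2 * r) s); last first.
    by have [-> _] := bump_outside r0 nbs; rewrite mul0r.
  by have [[_ hs] _] := hr s bs; rewrite mulr_ge0 ?bump_ge0 ?ltW.
have IF : box_integral tau (fun t => bump c r t * (b * E k t)) = 0.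
  rewrite (@eq_box_integral _ _ _ _ (fun t => b * (bump c r t * E k t) + 0)); last first.
    by move=> s _; rewrite addr0 mulrCA.
  rewrite (@box_integral_linear _ _ _ tau0 b (fun t => bump c r t * E k t) (fun=> 0)).
  - by rewrite IE box_integral0 mulr0 addr0.
  - by move=> s _; exact: cF0.
  - by move=> s _; exact: cst_continuous.
have bc' : box tau c by move=> a; have /andP[/ltW -> /ltW ->] := bc a.
have := box_integral_eq0 tau_gt0 (fun s => cF s I) F0 IF bc'.
apply/eqP; rewrite gt_eqF// mulr_gt0//; first exact: bump_center_gt0.
by have [_] := Ac.
Qed.

End EulerLagrange.

(** * Mean curvature *)

Section RegularExists.
Context {R : realType} {m n : nat} {M : riemannian_chart R n}.
Context {tau : 'rV[R]_m} {x0 x1 : 'rV[R]_n} {ub : option ('rV[R]_m -> 'M[R]_(m, n))}.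
Context {x : 'rV[R]_m -> 'rV[R]_n} {u : 'rV[R]_m -> 'M[R]_(m, n)}.

(** On the box the velocity is the control, whose rows are independent, so the determinant is
    positive there; this and chart membership extend to a neighbourhood by continuity. *)
Lemma regular_on_exists : (forall i, Ck_on 2 (box tau) (fun t => x t 0 i)) ->
  feasible M tau x0 x1 ub x u -> exists2 W, regular_on M W x & box tau `<=` W.
Proof.
move=> /choice[V hV] feas.
pose W0 := [set t | forall i, V i t].
have oW0 : open W0 by apply: open_forall => i; have [] := hV i.
have C2 i : Ck 2 W0 (fun t => x t 0 i).
  by have [_ _ h] := hV i; apply: Ck_sub h => t; exact.
have cx t : W0 t -> x s @[s --> t] --> x t.
  move=> Wt; apply: (@cvg_matrix _ _ (nbhs t)) => i j; rewrite ord1.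
  exact: (CkW (CkW (C2 j))).
have cv t a i : W0 t -> velocity x s a i @[s --> t] --> velocity x t a i.
  move=> Wt; rewrite mxE; under eq_cvg do rewrite mxE.
  have [_ h1] := C2 i; have h2 : Ck 1 W0 (pd a (fun s => x s 0 i)) := h1 a.
  have h3 : Ck 0 W0 (pd a (fun s => x s 0 i)) := CkW h2.
  exact: h3.
pose W := [set t | W0 t /\ (chart_dom M (x t) /\
  0 < \det (induced_metric M (x t) (velocity x t)))].
exists W; last first.
  move=> t bt; split; first by move=> i; have [_ h _] := hV i; exact: h.
  have xM := feasible_dom feas bt; split => //.
  rewrite (velocity_control feas bt); apply: det_induced_metric_gt0 => //.
  exact: (control_free (feasible_control feas)).
split.
- rewrite openE => t [W0t [xM det_gt0]]; apply: filterI; first exact: open_nbhs_nbhs.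
  apply: filterI.
    by apply: (cx t W0t); apply: open_nbhs_nbhs; split; [exact: chart_dom_open | exact: xM].
  have cdet := cvg_det_induced_metric (F := nbhs t) (cx t W0t) (fun a i => cv t a i W0t) xM.
  exact: (cvgr_gt _ (cdet _) _ det_gt0).
- by move=> i; apply: Ck_sub (C2 i) => t [].
- by move=> t [_ []].
- by move=> t [_ []].
Qed.

End RegularExists.

Section Minimal.
Context {R : realType} {m n : nat} {M : riemannian_chart R n}.
Context {W : set 'rV[R]_m} {x : 'rV[R]_m -> 'rV[R]_n}.
Hypothesis regx : regular_on M W x.

Lemma metric_unit y : chart_dom M y -> metric M y \in unitmx.
Proof.
by move=> yM; rewrite unitmxE unitfE gt_eqF// det_posdef_gt0// => w; exact: metric_pos.
Qed.

(** Exhibits the normal projection as multiplication by a fixed matrix, so that it commutes with the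
    trace over a and b. *)
Lemma normal_partE y (v : 'M[R]_(m, n)) Y : normal_part M y v Y =
  Y *m (1%:M - metric M y *m v^T *m invmx (induced_metric M y v) *m v).
Proof. by rewrite /normal_part mulmxBr mulmx1 !mulmxA. Qed.

Lemma normal_part_tangent y v (w : 'rV[R]_m) :
  chart_dom M y -> 0 < \det (induced_metric M y v) -> normal_part M y v (w *m v) = 0.
Proof.
move=> yM det_gt0; rewrite /normal_part.
have -> : w *m v *m metric M y *m v^T = w *m induced_metric M y v by rewrite /induced_metric !mulmxA.
by rewrite mulmxK ?subrr//; exact: induced_metric_unit.
Qed.

(** Lowering the upper index cancels the inverse metric and leaves the Christoffel symbols of the
    first kind. *)
Lemma metric_christoffel y k i j : chart_dom M y ->
  \sum_l metric M y k l * christoffel M l i j y =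
  2^-1 * (dmetric (M := M) i y j k + dmetric (M := M) j y i k - dmetric (M := M) k y i j).
Proof.
move=> yM; pose b := \col_l (pd i (fun z => metric M z j l) y +
   pd j (fun z => metric M z i l) y - pd l (fun z => metric M z i j) y).
have cE l : christoffel M l i j y = 2^-1 * (invmx (metric M y) *m b) l 0.
  by rewrite /christoffel mxE; congr (_ * _); apply: eq_bigr => p _; rewrite mxE.
under eq_bigr do rewrite cE mulrCA.
rewrite -big_distrr /=; congr (_ * _).
transitivity ((metric M y *m (invmx (metric M y) *m b)) k 0); first by rewrite [RHS]mxE.
by rewrite mulmxA mulmxV ?metric_unit// mul1mx !mxE.
Qed.

Lemma dmetric_sym k y i j : chart_dom M y ->
  dmetric (M := M) k y i j = dmetric (M := M) k y j i.
Proof.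
move=> yM; rewrite !mxE; apply: near_eq_derive.
have nM : \forall z \near y, chart_dom M z.
  by apply: open_nbhs_nbhs; split; [exact: chart_dom_open | exact: yM].
by apply: filterS nM => z zM; rewrite -{1}(metric_sym zM) mxE.
Qed.

(* In the Euler-Lagrange equation only the derivatives falling on g^{ab} sqrt(g)
   are not accounted for by the covariant derivatives of the velocity, and they
   multiply tangent vectors. *)
Lemma euler_form_cov k t : W t -> let N := cometric (M := M) (x t) (velocity x t) in
  - euler_form M (x := x) k t =
  \sum_a \sum_b N a b * (cov_velocity M x t a b *m metric M (x t)) 0 k +
  ((\row_b \sum_a pd a (fun s => cometric (M := M) (x s) (velocity x s) b a) t) *m
    velocity x t *m metric M (x t)) 0 k.
Proof.
move=> Wt N; have xM := regular_dom regx Wt; have det_gt0 := regular_det regx Wt.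
have symN : N^T = N by exact: cometric_sym xM det_gt0.
have NC a b : N a b = N b a by rewrite -[in LHS]symN mxE.
set g := metric M (x t); set v := velocity x t.
have symg : g^T = g by exact: metric_sym xM.
have gC i j : g i j = g j i by rewrite -[in LHS]symg mxE.
pose dg a : 'M[R]_n := \matrix_(i, j) pd a (fun s => metric M (x s) i j) t.
pose dv a : 'M[R]_(m, n) := \matrix_(b, j) pd a (fun s => velocity x s b j) t.
pose dN a : 'M[R]_m := \matrix_(b, c) pd a (fun s => cometric (M := M) (x s) (velocity x s) b c) t.
(* [Q a b], [Q b a] and [S a b] are the three metric derivatives of the first-kind Christoffel
   symbol contracted with v_a and v_b; [Q a b] also arises when d_a falls on the metric in
   [impulse], and [S a b] in [force]. *)
pose S a b := \sum_i \sum_j v a i * v b j * dmetric (M := M) k (x t) i j.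
pose Q a b := \sum_i \sum_j v a i * v b j * dmetric (M := M) i (x t) j k.
have d_impulse a : pd a (fun s => impulse (M := M) (x s) (velocity x s) k a) t =
    (((dg a *m v^T + g *m (dv a)^T) *m N) + g *m v^T *m dN a) k a.
  have h1 i j : is_derive t (delta_mx 0 a) (fun s => metric M (x s) i j) (dg a i j).
    by rewrite mxE; apply: is_derive_pd; exact: (metric_C1 regx i j).1.
  have h2 j b : is_derive t (delta_mx 0 a) (fun s => (velocity x s)^T j b) ((dv a)^T j b).
    rewrite !mxE (_ : (fun s => _) = (fun s => velocity x s b j)); last first.
      by apply/funext => s; rewrite mxE.
    by apply: is_derive_pd; exact: (velocity_C1 regx b j).1.
  have h3 b c : is_derive t (delta_mx 0 a)
      (fun s => cometric (M := M) (x s) (velocity x s) b c) (dN a b c).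
    by rewrite mxE; apply: is_derive_pd; exact: (cometric_C1 regx b c).1.
  have h := is_derive_mulmx_entry (is_derive_mulmx_entry h1 h2) h3 k a.
  exact: (@derive_val _ _ _ _ _ _ _ h).
have dgE a b : (dg a *m v^T) k b = Q a b.
  rewrite mxE /Q exchange_big /=; apply: eq_bigr => j _; rewrite !mxE.
  have hx l : is_derive t (delta_mx 0 a) (fun s => x s 0 l) ((row a v) 0 l).
    rewrite !mxE; apply: is_derive_pd.
    by have [hd _] := regular_C2 regx l; exact: hd.
  have h := is_derive_comp hx (metric_differentiable k j xM).
  rewrite [X in X * _](@derive_val _ _ _ _ _ _ _ h) big_distrl /=.
  by apply: eq_bigr => i _; rewrite mulrAC -(dmetric_sym _ _ _ xM) !mxE.
have covE a b : (cov_velocity M x t a b *m g) 0 k =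
    (g *m (dv a)^T) k b + 2^-1 * (Q a b + Q b a - S a b).
  have -> : Q b a = \sum_i \sum_j v a i * v b j * dmetric (M := M) j (x t) i k.
    rewrite /Q exchange_big /=; apply: eq_bigr => i _; apply: eq_bigr => j _.
    by rewrite [v b _ * _]mulrC.
  rewrite /Q /S -!big_split -sumrB big_distrr !mxE /=.
  transitivity (\sum_l (g k l * dv a b l + \sum_i \sum_j
      v a i * v b j * (g k l * christoffel M l i j (x t)))).
    apply: eq_bigr => l _; rewrite !mxE mulrDl gC mulrC; congr (_ + _).
      by have -> : pd b (fun r => x r 0 l) = (fun s => velocity x s b l)
        by apply/funext => s; rewrite mxE.
    rewrite big_distrl; apply: eq_bigr => i _; rewrite big_distrl.
    by apply: eq_bigr => j _ /=; rewrite /v; ring.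
  rewrite big_split /=; congr (_ + _); first by apply: eq_bigr => l _; rewrite !mxE.
  rewrite exchange_big; apply: eq_bigr => i _ /=; rewrite exchange_big.
  rewrite -big_split -sumrB big_distrr; apply: eq_bigr => j _ /=.
  by rewrite -big_distrr /= (metric_christoffel _ _ _ xM); ring.
have forceE : force (M := M) k (x t) v = 2^-1 * \sum_a \sum_b N a b * S a b.
  rewrite /force; congr (_ * _); rewrite exchange_big /=; apply: eq_bigr => b _.
  rewrite mxE; apply: eq_bigr => a _; rewrite NC; congr (_ * _).
  rewrite mxE /S; under eq_bigr do rewrite [(_ *m _) _ _]mxE [_^T _ _]mxE big_distrl /=.
  rewrite exchange_big /=; apply: eq_bigr => i _; apply: eq_bigr => j _.
  by rewrite mulrAC.
(* Against the symmetric [N] the two [Q] terms coincide, so half their sum is the single [Q] term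
   produced by differentiating [impulse]. *)
have QC : \sum_a \sum_b N a b * Q b a = \sum_a \sum_b N a b * Q a b.
  by rewrite exchange_big /=; apply: eq_bigr => a _; apply: eq_bigr => b _; rewrite NC.
(* The derivatives of [N] assemble into a combination of the rows of [v], that is, a tangent vector
   with its index lowered. *)
have wE : ((\row_b \sum_a dN a b a) *m v *m g) 0 k =
    \sum_a \sum_b (g *m v^T) k b * dN a b a.
  rewrite -mulmxA -[v *m g]trmxK trmx_mul symg mxE exchange_big; apply: eq_bigr => b _ /=.
  by rewrite [in LHS]mxE [X in _ * X]mxE mulrC big_distrr.
have -> : \row_b \sum_a pd a (fun s => cometric (M := M) (x s) (velocity x s) b a) t =
    \row_b \sum_a dN a b a.
  by apply/rowP => b; rewrite !mxE; apply: eq_bigr => a _; rewrite mxE.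
rewrite wE /euler_form opprB forceE.
transitivity (\sum_a \sum_b N a b * ((g *m (dv a)^T) k b + Q a b) +
    \sum_a \sum_b (g *m v^T) k b * dN a b a - 2^-1 * \sum_a \sum_b N a b * S a b).
  congr (_ - _); rewrite -big_split; apply: eq_bigr => a _ /=.
  rewrite d_impulse mxE; congr (_ + _); last by rewrite mxE.
  by rewrite mxE; apply: eq_bigr => b _; rewrite mxE dgE NC mulrC addrC.
rewrite addrAC; congr (_ + _).
have -> : \sum_a \sum_b N a b * (cov_velocity M x t a b *m g) 0 k =
    \sum_a \sum_b N a b * (g *m (dv a)^T) k b + 2^-1 *
    (\sum_a \sum_b N a b * Q a b + \sum_a \sum_b N a b * Q b a - \sum_a \sum_b N a b * S a b).
  rewrite -!big_split -sumrB big_distrr -big_split; apply: eq_bigr => a _ /=.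
  rewrite -!big_split -sumrB big_distrr -big_split; apply: eq_bigr => b _ /=.
  by rewrite covE; ring.
have -> : \sum_a \sum_b N a b * ((g *m (dv a)^T) k b + Q a b) =
    \sum_a \sum_b N a b * (g *m (dv a)^T) k b + \sum_a \sum_b N a b * Q a b.
  rewrite -big_split; apply: eq_bigr => a _; rewrite -big_split; apply: eq_bigr => b _ /=.
  exact: mulrDr.
by rewrite QC; field.
Qed.

Lemma mean_curvature_eq0 t : W t -> (forall k, euler_form M (x := x) k t = 0) ->
  mean_curvature M x t = 0.
Proof.
move=> Wt E0; have xM := regular_dom regx Wt; have det_gt0 := regular_det regx Wt.
set N := cometric (M := M) (x t) (velocity x t).
set w := \row_b \sum_a pd a (fun s => cometric (M := M) (x s) (velocity x s) b a) t.
have s0 : 0 < Num.sqrt (\det (induced_metric M (x t) (velocity x t))) by rewrite sqrtr_gt0.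
(* The equations for all k state an equality of vectors after lowering the index; the metric is
   invertible, so the vectors themselves agree. *)
have key : \sum_a \sum_b N a b *: cov_velocity M x t a b = - (w *m velocity x t).
  apply: (can_inj (mulmxK (metric_unit xM))).
  apply/rowP => k; rewrite mulNmx [RHS]mxE.
  have := euler_form_cov k Wt; rewrite E0 oppr0 => /esym/eqP; rewrite addr_eq0 => /eqP <-.
  rewrite mulmx_suml summxE; apply: eq_bigr => a _.
  rewrite mulmx_suml summxE; apply: eq_bigr => b _.
  by rewrite -scalemxAl mxE.
have hN a b : invmx (induced_metric M (x t) (velocity x t)) a b =
    (Num.sqrt (\det (induced_metric M (x t) (velocity x t))))^-1 * N a b.
  by rewrite /N cometricE// mxE mulKf ?gt_eqF.
rewrite /mean_curvature /second_fundamental_form.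
transitivity ((Num.sqrt (\det (induced_metric M (x t) (velocity x t))))^-1 *:
    normal_part M (x t) (velocity x t) (\sum_a \sum_b N a b *: cov_velocity M x t a b)).
  rewrite normal_partE mulmx_suml scaler_sumr; apply: eq_bigr => a _.
  rewrite mulmx_suml scaler_sumr; apply: eq_bigr => b _.
  by rewrite -scalemxAl scalerA -hN normal_partE.
by rewrite key -mulNmx normal_part_tangent// scaler0.
Qed.

End Minimal.

Theorem theorem5p1 (R : realType) (m n : nat) (M : riemannian_chart R n)
    (tau : 'rV[R]_m) (htau : forall a, 0 < tau 0 a)
    (x0 x1 : 'rV[R]_n) (ub : option ('rV[R]_m -> 'M[R]_(m, n)))
    (x : 'rV[R]_m -> 'rV[R]_n) (u : 'rV[R]_m -> 'M[R]_(m, n))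
    (hx : forall i, Ck_on 2 (box tau) (fun t => x t 0 i))
    (hopt : optimal M tau x0 x1 ub x u) :
  boundary_problem M tau x0 x1 x /\ minimal M tau x.
Proof.
have [feas _] := hopt.
have [W regx boxW] := regular_on_exists hx feas.
have E0 t k : box tau t -> euler_form M (x := x) k t = 0.
  (* For m = 0 there is no coordinate to place the endpoints off the open box, but then the trace
     and the sum in [euler_form] are empty. *)
  case: (posnP m) => [m0|m_gt0]; last by move=> bt; exact: (euler_form_eq0 m_gt0 htau regx boxW hopt).
  subst m; move=> _; rewrite /euler_form big_ord0 subr0 /force.
  by rewrite [\tr _]big_ord0 mulr0.
split; last by move=> t bt; apply: (mean_curvature_eq0 regx) => // [|k]; [exact: boxW | exact: E0].
split; [|exact: feasible_start feas|exact: feasible_end feas].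
move=> t bt k; rewrite (euler_formE regx); last exact: boxW.
by rewrite E0// oppr0.
Qed.
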